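(* Almost all cographs have a cospectral mate. That is, if $c_n$ denotes the number of isomorphism classes of cographs on $n$ vertices and $d_n$ the number of those isomorphism classes of cographs $G$ on $n$ vertices for which there exists a graph $H$ (not necessarily a cograph) with $H\not\cong G$ and $\mathrm{Spec}(H)=\mathrm{Spec}(G)$, then $d_n/c_n\to 1$ as $n\to\infty$.
   Context: A cograph is a finite simple graph obtained from the single-vertex graph by repeatedly applying disjoint union of two cographs and complementation (equivalently, a graph with no induced path on 4 vertices). For a graph $G$ with adjacency matrix $A$, $\mathrm{Spec}(G)$ is the multiset of eigenvalues of $A$. A cospectral mate of $G$ is a graph $H$ not isomorphic to $G$ with $\mathrm{Spec}(H)=\mathrm{Spec}(G)$. *)

(* Defs.v *)
From HB Require Import structures.
From mathcomp Require Import all_boot all_order all_algebra all_fingroup all_field.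
From mathcomp Require Import boolp.
Set Implicit Arguments. Unset Strict Implicit. Unset Printing Implicit Defensive.
Import Order.TTheory GRing.Theory Num.Theory.
Local Open Scope ring_scope.

Definition graph (n : nat) := {set 'I_n * 'I_n}.

Definition simple_graph n (E : graph n) : bool :=
  [forall x, forall y, ((x, y) \in E) == ((y, x) \in E)] && [forall x, (x, x) \notin E].

Definition graph_iso n (E F : graph n) : Prop :=
  exists s : 'S_n, forall x y, ((x, y) \in E) = ((s x, s y) \in F).

Definition graph_complement n (E : graph n) : graph n :=
  [set p | (p.1 != p.2) && (p \notin E)].

Definition graph_dunion m k (E : graph m) (F : graph k) : graph (m + k) :=
  [set p | match split p.1, split p.2 with
           | inl a, inl b => (a, b) \in E
           | inr a, inr b => (a, b) \in F
           | _, _ => false end].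

Inductive cograph : forall n, graph n -> Prop :=
| cograph_K1 : cograph (finset.set0 : graph 1)
| cograph_compl n (E : graph n) : cograph E -> cograph (graph_complement E)
| cograph_union m k (E : graph m) (F : graph k) :
    cograph E -> cograph F -> cograph (graph_dunion E F)
| cograph_iso n (E F : graph n) : cograph E -> graph_iso E F -> cograph F.

Definition adjmx n (E : graph n) : 'M[algC]_n := \matrix_(i, j) ((i, j) \in E)%:R.

Definition same_spectrum n m (E : graph n) (F : graph m) : Prop :=
  forall lam : algC, mup lam (char_poly (adjmx E)) = mup lam (char_poly (adjmx F)).

Definition has_cospectral_mate n (E : graph n) : Prop :=
  exists F : graph n, simple_graph F /\ ~ graph_iso E F /\ same_spectrum E F.

Definition cographs n : {set graph n} :=
  [set E : graph n | simple_graph E && `[< cograph E >]].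

Definition cograph_classes n : {set {set graph n}} :=
  equivalence_partition (fun E F : graph n => `[< graph_iso E F >]) (cographs n).

Definition c_num n : nat := #|cograph_classes n|.

Definition d_num n : nat :=
  #|[set C in cograph_classes n | `[< exists2 E, E \in C & has_cospectral_mate E >]]|.

(* Main.v *)
(* Suppose a cograph [M] has a mate [M'] containing an induced path on four
   vertices, where the two adjacency matrices are conjugate by an orthogonal
   matrix fixing the all-ones vector.  This property passes from [M] to every
   cograph obtained from it by disjoint unions and complements, and the
   resulting mate is never a cograph, hence never isomorphic to the graph it
   mates with.  Such an [M] exists on nine vertices.

   Cographs on [n] vertices correspond to canonical forests with [n] leaves of
   rooted trees without unary nodes, so it remains to see that almost all
   forests contain the tree of [M].  Let [s n] and [sg n] count trees and
   forests avoiding [M], and [u n] trees containing [M].  Grafting gives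
   [u n >= \sum_(j < n) sg (n - j) * u j].  Marking a leaf in a forest
   gives the Euler identity, which reads
   [n * s n = \sum_(j < n) j * s j * sg (n - j) + o(n * s n)].  Compared with the
   recurrence for [u], the weight [j / n] leaves room for a gain of a constant
   fraction of [s n], so [u n >= A * s n] eventually improves to
   [u n >= (A + c) * s n] with [c] independent of [A]; hence [u n / s n] tends
   to infinity. *)
Require Import Defs.
From HB Require Import structures.
From mathcomp Require Import all_boot all_order all_algebra all_fingroup all_field zify.
From mathcomp Require Import boolp.
Set Implicit Arguments. Unset Strict Implicit. Unset Printing Implicit Defensive.
Import Order.TTheory GRing.Theory Num.Theory.

(** * Growth of a dominated recurrence *)

Section Growth.

(** In the application [m] is the number of leaves of [M], the functions [s], [sg] and [u] are the
    counts of avoiding trees, avoiding forests and containing trees, and [e n k] counts the leaves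
    lying in trees of size [k] over all avoiding forests of size [n]. *)
Variables (m : nat) (s sg u : nat -> nat) (e : nat -> nat -> nat).
Hypothesis m_gt1 : 1 < m.
Hypothesis sg0 : sg 0 = 1.
Hypothesis s_gt0 : forall n, 0 < n -> 0 < s n.
Hypothesis s_le_sg : forall n, s n <= sg n.
Hypothesis sg_le3s : forall n, 0 < n -> sg n <= 3 * s n.
Hypothesis sg_eq2s : forall n, m < n -> sg n = 2 * s n.
Hypothesis sg_le_s : forall n, m <= n -> sg n <= s n.+1.
Hypothesis sg_mono : forall n, sg n <= sg n.+1.
Hypothesis e_sum : forall n, \sum_(1 <= k < n.+1) e n k = n * sg n.
Hypothesis e_rec : forall n k, 0 < k <= n ->
  e n k = k * s k * sg (n - k) + e (n - k) k.
Hypothesis e_0 : forall n k, n < k -> e n k = 0.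
Hypothesis u_m : 0 < u m.
Hypothesis u_rec : forall n, m < n ->
  \sum_(m <= j < n) sg (n - j) * u j <= u n.

(* [W] is the multiplicity-one part of the Euler identity and [Rm] the rest. *)
Let W n := \sum_(1 <= k < n) k * s k * sg (n - k).
Let Rm n := \sum_(1 <= k < n) e (n - k) k.
Let P n := \sum_(m <= j < n./2.+1) s j * sg (n - j).

Lemma sg_homo i j : i <= j -> sg i <= sg j.
Proof.
move=> /subnK <-; elim: (j - i) => [|k IH] //.
by rewrite addSn; apply: leq_trans IH (sg_mono _).
Qed.

Lemma sg_gt0 n : 0 < sg n.
Proof. by rewrite -sg0; apply: sg_homo. Qed.

(** The term [k = n] of [e_sum] is [n * s n]; it cancels one of the two copies of [n * s n] in
    [n * sg n]. *)
Lemma euler_split n : m < n -> n * s n = W n + Rm n.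
Proof.
move=> n_gt; have n_gt0 : 0 < n by lia.
have := e_sum n; rewrite (sg_eq2s n_gt) big_nat_recr //= e_rec ?n_gt0 ?leqnn //.
rewrite subnn sg0 e_0 // addn0 muln1.
under eq_big_nat => k /andP[k_gt0 k_lt] do rewrite e_rec ?k_gt0 ?(ltnW k_lt) //.
rewrite big_split /= -/(W n) -/(Rm n); lia.
Qed.

(** From [m] on, [sg] at least doubles at every step, so the last term controls the partial sums as
    in a geometric series; [C0] accounts for the indices below [m]. *)
Lemma sum_sg_le : exists C, forall n, \sum_(0 <= j < n) sg j <= C * sg n.
Proof.
pose C0 := \sum_(0 <= j < m) sg j; exists C0.+1 => n.
have [n_le|/ltnW] := leqP n m.
  have le0 : \sum_(0 <= j < n) sg j <= C0.
    by rewrite /C0 [leqRHS](big_cat_nat (n := n)) //= leq_addr.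
  have := sg_gt0 n; nia.
elim: n => [|n IH]; first by lia.
rewrite leq_eqVlt => /orP[/eqP m_eq|m_le].
  have := sg_gt0 n.+1; rewrite /C0 m_eq; nia.
rewrite big_nat_recr //=.
have sgS : 2 * sg n <= sg n.+1.
  by rewrite (sg_eq2s m_le); have := sg_le_s m_le; lia.
have := IH m_le; nia.
Qed.

Lemma sg_geometric n i : m <= n -> 2 ^ i * sg n <= sg (n + i).
Proof.
move=> n_ge; elim: i => [|i IH]; first by rewrite mul1n addn0.
have mni : m <= n + i by lia.
rewrite addnS (sg_eq2s (n := (n + i).+1)) // expnS.
have := sg_le_s mni; lia.
Qed.

(** Unfolding [e_rec] gives [k * s k] times [sg (n - k) + sg (n - 2 * k) + ...], with distinct
    indices below [n]. *)
Lemma e_le n k : 0 < k -> e n k <= k * s k * \sum_(0 <= j < n) sg j.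
Proof.
move=> k_gt0; elim/ltn_ind: n => n IH.
have [n_lt|k_le] := ltnP n k; first by rewrite e_0.
rewrite e_rec ?k_gt0 //.
have lt_nk : n - k < n by lia.
have := IH _ lt_nk.
have : \sum_(0 <= j < (n - k).+1) sg j <= \sum_(0 <= j < n) sg j.
  by rewrite [leqRHS](big_cat_nat (n := (n - k).+1)) //= leq_addr.
rewrite big_nat_recr //= => le1 le2.
apply: leq_trans (leq_add (leqnn _) le2) _.
by rewrite -mulnDr addnC leq_mul2l le1 orbT.
Qed.

Lemma e_le_sg n k : 0 < k -> e n k <= n * sg n.
Proof.
move=> k_gt0; have [n_lt|k_le] := ltnP n k; first by rewrite e_0.
rewrite -e_sum (bigD1_seq k) ?leq_addr ?iota_uniq //.
by rewrite mem_index_iota k_gt0 ltnS.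
Qed.

(** The terms with [k <= i] add up to a constant times [sg n], which lacks the factor [n]. The terms
    with [k > i] are at most [n * C * sg (n - i)], and [sg (n - i)] is exponentially small in [i]
    compared with [sg n]. *)
Lemma Rm_small q : exists N, forall n, N <= n -> q * Rm n <= n * s n.
Proof.
have [C HC] := sum_sg_le.
(* Since [i < 2 ^ i], this [i] keeps the tail, multiplied by [q], below half of [n * s n]; the other
   terms stay below the other half once [n >= 4 * q * D * C]. *)
pose i := 4 * q * C; pose D := \sum_(1 <= k < i.+1) k * s k.
exists (m + i + 4 * q * D * C).+1 => n n_ge.
have n_gtm : m < n by lia.
have le1 : \sum_(1 <= k < i.+1) e (n - k) k <= D * C * sg n.
  rewrite /D !big_distrl /= !big_nat; apply: leq_sum => k /andP[k_gt0 _].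
  apply: leq_trans (e_le _ k_gt0) _.
  rewrite -[leqRHS]mulnA leq_mul2l; apply/orP; right.
  by apply: leq_trans (HC _) _; rewrite leq_mul2l sg_homo ?orbT // leq_subr.
have le2 : \sum_(i.+1 <= k < n) e (n - k) k <= n * (C * sg (n - i)).
  apply: (@leq_trans (n * \sum_(i.+1 <= k < n) sg (n - k))).
    rewrite big_distrr /= !big_nat; apply: leq_sum => k /andP[k_gt0 _].
    apply: leq_trans (e_le_sg _ _) _; first by lia.
    by rewrite leq_mul2r leq_subr orbT.
  rewrite leq_mul2l; apply/orP; right.
  apply: leq_trans (HC _).
  rewrite big_nat_rev /=.
  have -> : \sum_(i.+1 <= k < n) sg (n - (i.+1 + n - k.+1)) =
            \sum_(i.+1 <= k < n) sg (k - i).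
    by apply: eq_big_nat => k /andP[k1 k2]; congr sg; lia.
  have -> : i.+1 = 1 + i by lia.
  have -> : n = (n - i) + i by lia.
  rewrite big_addn addnK.
  under eq_bigr do rewrite addnK.
  by rewrite [leqRHS](big_cat_nat (n := 1)) //= ?leq_addl //; lia.
have le3 : i * sg (n - i) <= sg n.
  have := @sg_geometric (n - i) i; rewrite subnK; last by lia.
  have : i < 2 ^ i by apply: ltn_expl.
  have : m <= n - i by lia.
  nia.
have -> : Rm n = \sum_(1 <= k < i.+1) e (n - k) k + \sum_(i.+1 <= k < n) e (n - k) k.
  by rewrite /Rm (big_cat_nat (n := i.+1)) //; lia.
rewrite (sg_eq2s n_gtm) in le1 le3.
have le4 : q * (n * (C * sg (n - i))) * 2 <= n * s n.
  have -> : q * (n * (C * sg (n - i))) * 2 = n * (2 * q * C * sg (n - i)) by lia.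
  rewrite leq_mul2l; apply/orP; right; rewrite /i in le3 *; lia.
have le5 : q * (D * C * (2 * s n)) * 2 <= n * s n.
  have -> : q * (D * C * (2 * s n)) * 2 = (4 * q * D * C) * s n by lia.
  by rewrite leq_mul2r; apply/orP; right; lia.
nia.
Qed.

(** Fold the sum at [n./2]. As [s (n - j) * sg j <= 3 * s j * sg (n - j)], the upper half costs at
    most three times the bound for the lower one. The indices below [m], absent from [P n], go into
    [C * sg n.-1]. *)
Lemma W_le : exists C, forall n, m.*2 <= n -> W n <= n * (4 * P n + C * sg n.-1).
Proof.
pose C1 := \sum_(1 <= j < m) s j; exists (4 * C1) => n n_ge.
have ltn2 : n./2 < n by lia.
pose H := \sum_(1 <= j < n./2.+1) s j * sg (n - j).
have H_le : H <= P n + C1 * sg n.-1.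
  rewrite /H (big_cat_nat (n := m)) /=; try lia.
  rewrite addnC leq_add2l /C1 big_distrl /= !big_nat.
  apply: leq_sum => j /andP[j_gt0 j_lt].
  by rewrite leq_mul2l sg_homo ?orbT //; lia.
suff : W n <= n * (4 * H) by nia.
rewrite /W (big_cat_nat (n := n./2.+1)) //=; try lia.
have le1 : \sum_(1 <= k < n./2.+1) k * s k * sg (n - k) <= n * H.
  rewrite /H big_distrr /= !big_nat; apply: leq_sum => j /andP[j_gt0 j_lt].
  by rewrite -mulnA leq_mul2r; apply/orP; right; lia.
have le2 : \sum_(n./2.+1 <= k < n) k * s k * sg (n - k) <= n * (3 * H).
  have -> : \sum_(n./2.+1 <= k < n) k * s k * sg (n - k) =
            \sum_(1 <= j < n - n./2) (n - j) * s (n - j) * sg j.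
    rewrite big_nat_rev /= -{1}[n./2.+1]add1n big_addn.
    apply: eq_big_nat => j /andP[j1 j2].
    have -> : n./2.+1 + n - (j + n./2).+1 = n - j by lia.
    by congr (_ * sg _); lia.
  apply: (@leq_trans (\sum_(1 <= j < n - n./2) n * (3 * (s j * sg (n - j))))).
    rewrite !big_nat; apply: leq_sum => j /andP[j_gt0 j_lt].
    rewrite -mulnA; apply: leq_mul; first by lia.
    rewrite mulnC mulnA; apply: leq_mul => //; exact: sg_le3s.
  rewrite -!big_distrr /= leq_mul2l leq_mul2l /=; apply/orP; right.
  rewrite /H [leqRHS](big_cat_nat (n := (n - n./2))) /=; try lia.
nia.
Qed.

Lemma P_homo i j : i <= j -> P i <= P j.
Proof.
move=> le_ij; rewrite /P.
have [m_le|lt_m] := leqP m i./2.+1; last by rewrite big_geq //; lia.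
rewrite [leqRHS](big_cat_nat (n := i./2.+1)) //=; last by lia.
apply: leq_trans _ (leq_addr _ _).
rewrite !big_nat; apply: leq_sum => k _.
by rewrite leq_mul2l sg_homo ?orbT //; lia.
Qed.

(** This is what makes the gain a constant fraction of [s n]. With [Rm n] at most half of [n * s n],
    the Euler identity yields [s n <= 8 * P n + L * s n.-1]. After [m] iterations the remainder
    [s (n - m)] is bounded by the term [j = m] of [P n]. *)
Lemma s_le_P : exists q N, forall n, N <= n -> s n <= q * P n.
Proof.
have [C HC] := W_le; have [N0 HN0] := Rm_small 2.
pose L := 4 * C; pose N1 := m.*2 + N0 + m.+2.
have step n : N1 <= n -> s n <= 8 * P n + L * s n.-1.
  move=> n_ge; have n_gtm : m < n by lia.
  have W1 := HC n ltac:(lia).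
  have R1 : 2 * Rm n <= n * s n by apply: HN0; lia.
  have E1 := euler_split n_gtm.
  rewrite (sg_eq2s (n := n.-1)) in W1; last by lia.
  have : n * s n <= n * (8 * P n + L * s n.-1).
    by rewrite /L; nia.
  by rewrite leq_mul2l; case/orP => [/eqP|//]; lia.
have iter i : exists q, forall n, N1 + i <= n -> s n <= q * P n + L ^ i * s (n - i).
  elim: i => [|i [q Hq]]; first by exists 0 => n _; rewrite subn0 mul1n.
  exists (q + L ^ i * 8) => n n_ge.
  have := Hq n ltac:(lia); have := step (n - i) ltac:(lia).
  have -> : (n - i).-1 = n - i.+1 by lia.
  have := @P_homo (n - i) n ltac:(lia).
  rewrite expnSr; move: (L ^ i) => Li PP S1 S2.
  have : Li * s (n - i) <= Li * (8 * P n + L * s (n - i.+1)).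
    by rewrite leq_mul2l; apply/orP; right; lia.
  nia.
have [q Hq] := iter m; exists (q + L ^ m), (N1 + m + m.*2) => n n_ge.
have := Hq n ltac:(lia).
have : s (n - m) <= P n.
  have lt2 : m < n./2.+1 by lia.
  apply: leq_trans (s_le_sg _) _; rewrite /P big_ltn //.
  have := s_gt0 (n := m) ltac:(lia); nia.
move: (L ^ m) => Lm; nia.
Qed.

(** Lower bounds on [u j] will be available only from some [K] on; discarding the smaller indices
    costs a constant times [sg n.-1], which [error_small] absorbs. *)
Lemma Z_split K n : m < n -> m <= K <= n ->
  n * s n <= \sum_(K <= j < n) j * s j * sg (n - j) + Rm n +
     (\sum_(1 <= j < K) j * s j) * sg n.-1.
Proof.
move=> n_gt /andP[K1 K2]; rewrite (euler_split n_gt) /W (big_cat_nat (n := K)) //=; last by lia.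
suff : \sum_(1 <= k < K) k * s k * sg (n - k) <= (\sum_(1 <= j < K) j * s j) * sg n.-1 by lia.
rewrite big_distrl /= !big_nat; apply: leq_sum => k /andP[k_gt0 _].
by rewrite leq_mul2l sg_homo ?orbT //; lia.
Qed.

Lemma P_le n : m.*2 <= n ->
  n * P n <= 2 * \sum_(m <= j < n) (n - j) * (s j * sg (n - j)).
Proof.
move=> n_ge; rewrite /P [X in 2 * X](big_cat_nat (n := n./2.+1)) //=; try lia.
rewrite mulnDr; apply: leq_trans _ (leq_addr _ _).
rewrite !big_distrr /= !big_nat; apply: leq_sum => j /andP[j_ge j_lt].
by rewrite [leqRHS]mulnA leq_mul2r; apply/orP; right; lia.
Qed.

Lemma u_gt0 n : m <= n -> 0 < u n.
Proof.
rewrite leq_eqVlt => /orP[/eqP <- //|n_gt].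
apply: leq_trans (u_rec n_gt); rewrite big_ltn //.
have := sg_gt0 (n - m); nia.
Qed.

(* The recurrence for [u] splits as [n = j + (n - j)]: the part weighted by [j]
   reproduces [n * s n] by the Euler identity, and the part weighted by [n - j]
   is a gain comparable with [n * P n]. *)
Lemma gain B c G K n : m < n -> m <= K <= n -> m.*2 <= n ->
  (forall j, m <= j < n -> c.*2 * s j <= G * u j) ->
  (forall j, K <= j < n -> B * s j <= G * u j) ->
  B * (n * s n) + c * (n * P n) <=
    n * (G * u n) + B * (Rm n + (\sum_(1 <= j < K) j * s j) * sg n.-1).
Proof.
move=> n_gt Kn n_ge Hc HB.
have U1 : n * (G * \sum_(m <= j < n) sg (n - j) * u j) <= n * (G * u n).
  by rewrite !leq_mul2l u_rec ?orbT.
have U2 : n * (G * \sum_(m <= j < n) sg (n - j) * u j) =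
   \sum_(m <= j < n) j * (sg (n - j) * (G * u j)) +
   \sum_(m <= j < n) (n - j) * (sg (n - j) * (G * u j)).
  rewrite -big_split /= !big_distrr /=; apply: eq_big_nat => j /andP[j1 j2].
  have {1}-> : n = j + (n - j) by lia.
  by rewrite mulnDl; congr (_ * _ + _ * _); lia.
(* The doubled constant [c.*2] in the hypothesis pays for the factor 2 in [P_le]. *)
have U3 : c * (n * P n) <= \sum_(m <= j < n) (n - j) * (sg (n - j) * (G * u j)).
  apply: (@leq_trans (c * (2 * \sum_(m <= j < n) (n - j) * (s j * sg (n - j))))).
    by rewrite leq_mul2l P_le ?orbT.
  rewrite mulnA big_distrr /= !big_nat; apply: leq_sum => j jn.
  have := Hc _ jn; move: (n - j) (sg (n - j)) => a b H.
  have -> : c * 2 * (a * (s j * b)) = a * (b * (c.*2 * s j)) by lia.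
  by rewrite !leq_mul2l H !orbT.
have U4 : B * \sum_(K <= j < n) j * s j * sg (n - j) <=
          \sum_(m <= j < n) j * (sg (n - j) * (G * u j)).
  rewrite [leqRHS](big_cat_nat (n := K)) //=; try lia.
  apply: leq_trans _ (leq_addl _ _).
  rewrite big_distrr /= !big_nat; apply: leq_sum => j jn.
  have := HB _ jn; move: (sg (n - j)) => b H.
  have -> : B * (j * s j * b) = j * (b * (B * s j)) by lia.
  by rewrite !leq_mul2l H !orbT.
have : B * (n * s n) <= B * (\sum_(K <= j < n) j * s j * sg (n - j) + Rm n +
     (\sum_(1 <= j < K) j * s j) * sg n.-1).
  by rewrite leq_mul2l Z_split ?orbT.
rewrite -addnA mulnDr; lia.
Qed.

Lemma error_small B K : exists N, forall n, N <= n ->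
  B * (Rm n + (\sum_(1 <= j < K) j * s j) * sg n.-1) <= n * s n.
Proof.
have [N HN] := Rm_small (2 * B); pose D := \sum_(1 <= j < K) j * s j.
exists (N + m.+2 + 2 * B * D) => n n_ge; rewrite -/D.
have R1 := HN n ltac:(lia).
have S1 : sg n.-1 <= s n.
  by have := @sg_le_s n.-1 ltac:(lia); rewrite prednK //; lia.
have : 2 * B * D * sg n.-1 <= n * s n.
  by apply: leq_mul => //; lia.
rewrite mulnDr; lia.
Qed.

(** Strong induction in which the constant must not deteriorate: with [c = 1] the gain [n * P n]
    outweighs the error, so the same [g] serves at [n]. It is chosen to cover the finitely many
    [n < N], where [u n] is positive. *)
Lemma s_le_u : exists g, forall n, m <= n -> s n <= g * u n.
Proof.
have [q [N0 HP]] := s_le_P.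
have [N1 HN1] := error_small (2 * q) m.
pose N := N0 + N1 + m.*2 + m.+1.
pose g := 2 * \sum_(0 <= j < N) s j; exists g => n.
elim/ltn_ind: n => n IH n_ge.
have [n_lt|N_le] := ltnP n N.
  have : s n <= \sum_(0 <= j < N) s j.
    by rewrite (bigD1_seq n) ?leq_addr ?iota_uniq ?mem_index_iota.
  have := u_gt0 n_ge; rewrite /g; nia.
have Hj j : m <= j < n -> 2 * s j <= (2 * g) * u j.
  by case/andP => j1 j2; have := IH j j2 j1; lia.
have := @gain 2 1 (2 * g) m n ltac:(lia) ltac:(lia) ltac:(lia) Hj Hj.
have := HN1 n ltac:(lia); have := HP n ltac:(lia).
move: (Rm n + _) => E P1 E1 G1.
have : n * s n <= n * (g * u n).
  have Q1 : q * (2 * E) <= q * (n * P n).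
    by have : n * s n <= n * (q * P n) by [rewrite leq_mul2l P1 orbT]; lia.
  case: (posnP q) => [q0|q_gt0]; last first.
    rewrite leq_mul2l in Q1; move: Q1; case: eqP => [|_ /= Q1]; lia.
  have := s_gt0 (n := n) ltac:(lia); move: P1; rewrite q0; lia.
by rewrite leq_mul2l; case/orP => [/eqP|//]; lia.
Qed.

(** Induction on [A] with [G] fixed. The bound of [s_le_u] allows [c = 2 * q], hence a gain of at
    least [2 * (n * s n)]: one copy absorbs the error and the other raises [A] by one. *)
Lemma u_dominates_s : exists G, forall A, exists N, forall n, N <= n -> A * s n <= G * u n.
Proof.
have [q [N0 HP]] := s_le_P; have [g Hg] := s_le_u.
exists (4 * q * g); elim=> [|A [K0 HK0]]; first by exists 0.
pose B := A + 4 * q; pose K := K0 + m.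
have [N1 HN1] := error_small A K.
exists (N0 + N1 + K + m.*2 + m.+1) => n n_ge.
have Hc j : m <= j < n -> (2 * q).*2 * s j <= 4 * q * g * u j.
  case/andP => j1 j2; have := Hg j j1; rewrite -!mulnA => H.
  have -> : (2 * q).*2 * s j = 4 * (q * s j) by lia.
  by rewrite !leq_mul2l H !orbT.
have HB j : K <= j < n -> A * s j <= 4 * q * g * u j.
  by case/andP => j1 j2; apply: HK0; lia.
have := @gain A (2 * q) _ K n ltac:(lia) ltac:(lia) ltac:(lia) Hc HB.
have := HN1 n ltac:(lia); have := HP n ltac:(lia).
move: (A * (Rm n + _)) => E P1 E1 G1.
have Q1 : n * s n <= n * (q * P n) by rewrite leq_mul2l P1 orbT.
have : n * (A.+1 * s n) <= n * (4 * q * g * u n) by lia.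
by rewrite leq_mul2l; case/orP => [/eqP|//]; lia.
Qed.

End Growth.

(** * Counting canonical trees and forests *)

Inductive tree := Node of seq tree.

Definition children (t : tree) : seq tree := let: Node s := t in s.

Lemma tree_foldr_ind (Q : tree -> Prop) :
  (forall s, foldr (fun t => and (Q t)) True s -> Q (Node s)) -> forall t, Q t.
Proof.
move=> H; fix IH 1 => -[s]; apply: H.
by elim: s => //= t s IHs; split.
Qed.

Fixpoint tree_encode (t : tree) : GenTree.tree unit :=
  let: Node s := t in GenTree.Node 0 (map tree_encode s).

Fixpoint tree_decode (g : GenTree.tree unit) : tree :=
  if g is GenTree.Node _ s then Node (map tree_decode s) else Node [::].

Lemma tree_encodeK : cancel tree_encode tree_decode.
Proof.
elim/tree_foldr_ind => s /= IH; congr Node.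
by elim: s IH => //= t s IHs [-> /IHs ->].
Qed.

HB.instance Definition _ := Countable.copy tree (can_type tree_encodeK).

Lemma tree_ind_mem (Q : tree -> Prop) :
  (forall s, {in s, forall t, Q t} -> Q (Node s)) -> forall t, Q t.
Proof.
move=> H; elim/tree_foldr_ind => s Hs; apply: H => t.
by elim: s Hs => //= c s IHs [Qc Qs]; rewrite inE => /orP[/eqP -> //|]; apply: IHs.
Qed.

Definition leaf := Node [::].

(* [maxn 1] gives a childless node one leaf; it is absorbed by the sum otherwise. *)
Fixpoint leaves (t : tree) : nat :=
  let: Node s := t in maxn 1 (sumn (map leaves s)).

Definition fleaves (f : seq tree) : nat := sumn (map leaves f).

(** Any total order would do: sorting children by it picks one sequence from each multiset, so that
    [canon] selects one representative of each unordered tree without unary nodes. *)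
Definition leT (t1 t2 : tree) : bool := pickle t1 <= pickle t2.

Fixpoint canon (t : tree) : bool :=
  let: Node s := t in [&& size s != 1, sorted leT s & all canon s].

(** The occurrence meant is a full one: [M] is a node of [t] together with all its descendants. *)
Fixpoint has_sub (M t : tree) : bool :=
  let: Node s := t in (Node s == M) || has (has_sub M) s.

Definition forest (p : pred tree) (n : nat) (f : seq tree) : bool :=
  [&& sorted leT f, all p f & fleaves f == n].

Definition fins (t : tree) (f : seq tree) : seq tree := sort leT (t :: f).

Lemma leT_total : total leT.
Proof. by move=> x y; apply: leq_total. Qed.

Lemma leT_trans : transitive leT.
Proof. by move=> x y z; apply: leq_trans. Qed.

Lemma leT_anti : antisymmetric leT.
Proof.
by move=> x y H; apply: (pcan_inj pickleK); apply/eqP; rewrite eqn_leq.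
Qed.

Lemma leaves_gt0 t : 0 < leaves t.
Proof. by case: t => s /=; rewrite leq_max. Qed.

Lemma size_le_fleaves f : size f <= fleaves f.
Proof.
elim: f => //= t f IH; have := leaves_gt0 t; rewrite /fleaves /= in IH *; lia.
Qed.

Lemma leaves_Node s : s != [::] -> leaves (Node s) = fleaves s.
Proof.
move=> s_n0; rewrite /= -/(fleaves s); apply/maxn_idPr.
by apply: leq_trans (size_le_fleaves s); case: s s_n0.
Qed.

Lemma fleaves_perm f g : perm_eq f g -> fleaves f = fleaves g.
Proof. by move=> fg; apply/perm_sumn/perm_map. Qed.

Lemma fleaves_mem (c : tree) (f : seq tree) : c \in f -> leaves c + (size f).-1 <= fleaves f.
Proof.
move=> cf; rewrite (fleaves_perm (perm_to_rem cf)) /fleaves /= leq_add2l.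
by rewrite -(size_rem cf); apply: size_le_fleaves.
Qed.

Lemma fins_perm t f : perm_eq (fins t f) (t :: f).
Proof. by rewrite /fins perm_sort. Qed.

Lemma fins_inj t f g : sorted leT f -> sorted leT g -> fins t f = fins t g -> f = g.
Proof.
move=> sf sg E; have := fins_perm t g.
rewrite -E (permPl (fins_perm t f)) perm_cons => fg.
exact: (sorted_eq leT_trans leT_anti).
Qed.

Lemma forest_fins (p : pred tree) t n f :
  p t -> forest p n f -> forest p (leaves t + n) (fins t f).
Proof.
move=> pt /and3P[sf af /eqP nf]; apply/and3P; split.
- exact: (sort_sorted leT_total).
- by rewrite (perm_all _ (fins_perm t f)) /= pt.
- by rewrite (fleaves_perm (fins_perm t f)) /fleaves /= -/(fleaves f) nf.
Qed.

Lemma forest_rem (p : pred tree) c n f :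
  c \in f -> forest p n f -> forest p (n - leaves c) (rem c f).
Proof.
move=> cf /and3P[sf af /eqP nf]; apply/and3P; split.
- exact: (subseq_sorted leT_trans (rem_subseq _ _)).
- by apply/allP => x /mem_rem xf; exact: (allP af).
- by rewrite -nf (fleaves_perm (perm_to_rem cf)) /fleaves /= addKn.
Qed.

Lemma fins_rem c f : sorted leT f -> c \in f -> fins c (rem c f) = f.
Proof.
move=> sf cf; apply: (sorted_eq leT_trans leT_anti) => //.
  exact: (sort_sorted leT_total).
by rewrite (permPl (fins_perm _ _)) perm_sym perm_to_rem.
Qed.

Lemma size_inj_le (T1 T2 : eqType) (g : T1 -> T2) s1 s2 :
  uniq s1 -> {in s1 &, injective g} -> {in s1, forall x, g x \in s2} ->
  size s1 <= size s2.
Proof.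
move=> u1 gi gs; rewrite -(size_map g); apply: uniq_leq_size.
  by rewrite map_inj_in_uniq.
by move=> _ /mapP[x xs ->]; apply: gs.
Qed.

Fixpoint seqs_upto (T : Type) (j : nat) (l : seq T) : seq (seq T) :=
  if j is j'.+1 then [::] :: [seq x :: s | x <- l, s <- seqs_upto j' l]
  else [:: [::]].

Lemma mem_seqs_upto (T : eqType) j (l s : seq T) :
  size s <= j -> {subset s <= l} -> s \in seqs_upto j l.
Proof.
elim: j s => [|j IH] [|x s] //= sz sub.
rewrite inE; apply/orP; right; apply: allpairs_f; first by apply: sub; rewrite mem_head.
by apply: IH => // y ys; apply: sub; rewrite inE ys orbT.
Qed.

(** A finite superset suffices, since [trees] and [forests] filter it and remove repetitions. *)
Fixpoint trees_upto (k : nat) : seq tree :=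
  if k is k'.+1 then [seq Node s | s <- seqs_upto k (trees_upto k')] else [::].

(** Without unary nodes, every child has fewer leaves than its parent, so the number of leaves
    bounds both the depth and the width. *)
Lemma mem_trees_upto k t : canon t -> leaves t <= k -> t \in trees_upto k.
Proof.
elim: k t => [|k IH] t ct lt; first by have := leaves_gt0 t; lia.
case: t ct lt => s; have [-> _ _|s_n0] := eqVneq s [::].
  by apply: map_f; apply: mem_seqs_upto.
rewrite leaves_Node // => /and3P[s1 _ /allP cs] lt; apply: map_f.
apply: mem_seqs_upto; first exact: leq_trans (size_le_fleaves s) lt.
move=> c c_s; apply: IH; first exact: cs.
have sz : 1 < size s by case: s s1 s_n0 {lt cs c_s} => [|x [|y s]].
have : leaves c + (size s).-1 <= fleaves s := fleaves_mem c_s.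
lia.
Qed.

Definition trees (p : pred tree) n :=
  undup (filter (fun t => p t && (leaves t == n)) (trees_upto n)).

Definition forests (p : pred tree) n :=
  undup (filter (forest p n) (seqs_upto n (trees_upto n))).

Section Counting.

Variable p : pred tree.
Hypothesis p_canon : subpred p canon.

Lemma mem_trees n t : (t \in trees p n) = p t && (leaves t == n).
Proof.
rewrite mem_undup mem_filter; case: (boolP (p t)) => //= pt.
by case: eqP => //= <-; rewrite mem_trees_upto // p_canon.
Qed.

Lemma mem_forests n f : (f \in forests p n) = forest p n f.
Proof.
rewrite mem_undup mem_filter; apply/andb_idr => /and3P[_ /allP af /eqP nf].
apply: mem_seqs_upto; first by rewrite -nf size_le_fleaves.
move=> t tf; apply: mem_trees_upto; first exact/p_canon/af.
by rewrite -nf; apply: leq_trans (fleaves_mem tf); apply: leq_addr.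
Qed.

(* The number of leaves lying in trees of size [k], over all forests of size [n]. *)
Definition occ n k :=
  k * \sum_(c <- trees p k) \sum_(f <- forests p n) count_mem c f.

Lemma forests_uniq n : uniq (forests p n). Proof. exact: undup_uniq. Qed.
Lemma trees_uniq n : uniq (trees p n). Proof. exact: undup_uniq. Qed.

Lemma occ_0 n k : n < k -> occ n k = 0.
Proof.
move=> lt_nk; rewrite /occ big_seq big1 ?muln0 // => c.
rewrite mem_trees => /andP[_ /eqP lc].
rewrite big_seq big1 // => f; rewrite mem_forests => /and3P[_ _ /eqP lf].
by apply/count_memPn/negP => /fleaves_mem; lia.
Qed.

(** Removing one copy of [c] is a bijection from the forests of size [n] containing [c] to all
    forests of size [n - k], and it lowers the multiplicity of [c] by one. *)
Lemma occ_rec n k : 0 < k <= n ->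
  occ n k = k * size (trees p k) * size (forests p (n - k)) + occ (n - k) k.
Proof.
case/andP => k_gt0 k_le; rewrite /occ -mulnA -mulnDr; congr (_ * _).
rewrite -sum1_size big_distrl -big_split /= big_seq [RHS]big_seq.
apply: eq_bigr => c; rewrite mem_trees => /andP[pc /eqP lc].
rewrite mul1n (bigID (fun f => c \in f)) /= addnC big1 ?add0n; last first.
  by move=> f /count_memPn.
rewrite -big_filter (perm_big (map (fins c) (forests p (n - k)))) /=; last first.
  apply: uniq_perm; first by rewrite filter_uniq // forests_uniq.
    rewrite map_inj_in_uniq ?forests_uniq // => f g.
    rewrite !mem_forests => /and3P[sf _ _] /and3P[sg _ _]; exact: fins_inj.
  move=> f; rewrite mem_filter mem_forests; apply/andP/mapP => [[cf ff]|[g]].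
    exists (rem c f); first by rewrite mem_forests -lc forest_rem.
    by rewrite fins_rem //; case/and3P: ff.
  rewrite mem_forests => fg ->; split.
    by rewrite (perm_mem (fins_perm _ _)) mem_head.
  by have := forest_fins pc fg; rewrite lc subnKC.
rewrite big_map -sum1_size -big_split /=; apply: eq_bigr => f _.
by rewrite (seq.permP (fins_perm c f)) /= eqxx.
Qed.

(** Each tree [x] of a forest is counted once, at [k = leaves x] and [c = x], with weight
    [leaves x]; a forest thus contributes its number of leaves. *)
Lemma occ_sum n : \sum_(1 <= k < n.+1) occ n k = n * size (forests p n).
Proof.
have -> : \sum_(1 <= k < n.+1) occ n k =
    \sum_(f <- forests p n) \sum_(1 <= k < n.+1) \sum_(c <- trees p k) k * count_mem c f.
  rewrite exchange_big /=; apply: eq_bigr => k _.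
  rewrite /occ big_distrr exchange_big /=; apply: eq_bigr => c _.
  by rewrite big_distrr.
rewrite -sum1_size big_distrr /= big_seq [RHS]big_seq.
apply: eq_bigr => f; rewrite mem_forests => /and3P[_ af /eqP lf]; rewrite muln1.
(* Unlike the equality, this inequality passes to the tail of [f] in the induction. *)
have le_n : fleaves f <= n by rewrite lf.
rewrite -[RHS]lf {lf}; elim: f af le_n => [|x f IH] /=.
  by move=> _ _; rewrite big1 // => k _; rewrite big1 // => c _; rewrite muln0.
rewrite /fleaves /= -/(fleaves f) => /andP[px af] le_n.
rewrite -IH //; last by lia.
under eq_bigr => k _ do under eq_bigr => c _ do rewrite mulnDr.
under eq_bigr => k _ do rewrite big_split /=.
rewrite big_split /=; congr (_ + _).
rewrite (bigD1_seq (leaves x)) ?iota_uniq ?mem_index_iota ?leaves_gt0 ?ltnS //=; last by lia.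
rewrite (bigD1_seq x) ?trees_uniq ?mem_trees ?px ?eqxx //= muln1.
rewrite big1 ?addn0 => [|c]; last by rewrite eq_sym => /negPf ->; rewrite muln0.
rewrite big1 ?addn0 // => k; rewrite eq_sym => lxk; rewrite big_seq big1 // => c.
rewrite mem_trees => /andP[_ /eqP lc]; case: eqP => [xc|]; last by rewrite muln0.
by rewrite -lc xc eqxx in lxk.
Qed.

Lemma forests0 : forests p 0 = [:: [::]].
Proof. by []. Qed.

Lemma trees_le_forests n : size (trees p n) <= size (forests p n).
Proof.
apply: (@size_inj_le _ _ (fun t => [:: t])); first exact: trees_uniq.
  by move=> t1 t2 _ _ [].
move=> t; rewrite mem_trees mem_forests => /andP[pt lt].
by rewrite /forest /= pt /fleaves /= addn0 lt.
Qed.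

End Counting.

(** * Trees and forests avoiding or containing a fixed subtree *)

Section Avoiding.

Variable M : tree.
Hypothesis M_canon : canon M.
Hypothesis M_leaves : 2 < leaves M.

Definition avoiding : pred tree := fun t => canon t && ~~ has_sub M t.
Definition containing : pred tree := fun t => canon t && has_sub M t.

Let m := leaves M.
Let s n := size (trees avoiding n).
Let sg n := size (forests avoiding n).
Let u n := size (trees containing n).

Lemma avoiding_canon : subpred avoiding canon.
Proof. by move=> t /andP[]. Qed.

Lemma containing_canon : subpred containing canon.
Proof. by move=> t /andP[]. Qed.

Lemma avoiding_leaf : avoiding leaf.
Proof.
rewrite /avoiding /= orbF; apply: contraTN M_leaves => /eqP <-.
by [].
Qed.

Lemma avoiding_Node f : f != [::] -> avoiding (Node f) ->
  forest avoiding (leaves (Node f)) f.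
Proof.
move=> f_n0 /andP[/= /and3P[_ sf cf]]; rewrite negb_or -all_predC => /andP[_ nf].
rewrite -/(leaves (Node f)) leaves_Node // /forest sf eqxx andbT /=.
by apply/allP => t tf; rewrite /avoiding (allP cf) //; exact: (allP nf).
Qed.

Lemma canon_Node p n f : subpred p canon -> forest p n f -> size f != 1 ->
  canon (Node f).
Proof.
by move=> pc /and3P[sf af _] f1; rewrite /= f1 sf /=; apply: sub_all af.
Qed.

Lemma Node_avoiding n f : forest avoiding n f -> size f != 1 -> Node f != M ->
  avoiding (Node f).
Proof.
move=> ff f1 fM; rewrite /avoiding (canon_Node avoiding_canon ff) //=.
rewrite (negPf fM) -all_predC; case/and3P: ff => _ af _.
by apply: sub_all af => t /andP[].
Qed.

Lemma forest_size n f : forest avoiding n f -> 0 < n -> f != [::].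
Proof. by case: f => // /and3P[_ _ /eqP <-]. Qed.

Lemma children_inj : injective children.
Proof. by move=> [a] [b] /= ->. Qed.

(** A forest is either a single tree or the list of children of a tree; the latter tree avoids [M]
    unless it is [M] itself, which requires [n = m]. *)
Lemma avoiding_forests_le_aux n : 1 < n -> sg n <= s n + size (trees avoiding n ++ nseq (n == m) M).
Proof.
move=> n_gt1; rewrite /sg -(count_predC (fun f => size f == 1)) -!size_filter.
apply: leq_add.
  apply: (@size_inj_le _ _ (head leaf)); first by rewrite filter_uniq ?forests_uniq.
    move=> f g; rewrite !mem_filter => /andP[f1 _] /andP[g1 _].
    by case: f f1 => [|x []] // _; case: g g1 => [|y []] // _ /= ->.
  move=> f; rewrite mem_filter mem_forests; last exact: avoiding_canon.
  case: f => [|x []] // /andP[_ /and3P[_ af]].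
  rewrite /= /fleaves /= addn0 mem_trees; last exact: avoiding_canon.
  by move: af => /= /andP[-> _].
apply: (@size_inj_le _ _ Node); first by rewrite filter_uniq ?forests_uniq.
  by move=> f g _ _ [].
move=> f; rewrite mem_filter mem_forests => [/andP[/= f1 ff]|]; last exact: avoiding_canon.
have f_n0 : f != [::] by apply: forest_size ff _; lia.
have lf : leaves (Node f) = n.
  by rewrite leaves_Node //; case/and3P: ff => _ _ /eqP.
rewrite mem_cat mem_trees; last exact: avoiding_canon.
rewrite lf eqxx andbT; case: (eqVneq (Node f) M) => [fM|fM].
  by rewrite fM /m -fM lf eqxx /= mem_seq1 eqxx orbT.
by rewrite (Node_avoiding ff).
Qed.

Lemma avoiding_forests_le n : 0 < n -> sg n <= 2 * s n + (n == m).
Proof.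
move=> n_gt0; have [n_gt1|n_le1] := ltnP 1 n.
  by have := avoiding_forests_le_aux n_gt1; rewrite size_cat size_nseq; rewrite /s; lia.
have -> : n = 1 by lia.
have : sg 1 <= s 1; last by lia.
apply: (@size_inj_le _ _ (head leaf)); first by rewrite forests_uniq.
  move=> f g; rewrite !mem_forests; try exact: avoiding_canon.
  move=> /and3P[_ _ /eqP lf] /and3P[_ _ /eqP lg].
  have := size_le_fleaves f; have := size_le_fleaves g; rewrite lf lg.
  by case: f lf => [|x []] // _; case: g lg => [|y []] // _ _ _ /= ->.
move=> f; rewrite mem_forests ?mem_trees; try exact: avoiding_canon.
move=> /and3P[_ af /eqP lf]; have := size_le_fleaves f; rewrite lf.
case: f af lf => [|x []] //= /andP[-> _].
by rewrite /fleaves /= addn0 => ->.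
Qed.

(** A tree gives two forests, itself alone and its children. The two families are disjoint because a
    canonical node never has exactly one child. *)
Lemma avoiding_forests_ge n : 1 < n -> 2 * s n <= sg n.
Proof.
move=> n_gt1; rewrite /s mul2n -addnn -{1}(size_map (fun t => [:: t])).
rewrite -(size_map children) -size_cat; apply: uniq_leq_size.
  rewrite cat_uniq !map_inj_uniq ?trees_uniq //=; try exact: children_inj; last first.
    by move=> x y [].
  rewrite andbT; apply/hasPn => f /mapP[t]; rewrite mem_trees; last exact: avoiding_canon.
  case: t => g /andP[/andP[/and3P[g1 _ _] _] _] -> /=.
  by apply/mapP => -[x _ gx]; rewrite gx in g1.
move=> f; rewrite mem_cat mem_forests; last exact: avoiding_canon.
case/orP => /mapP[t]; rewrite mem_trees; try exact: avoiding_canon.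
  by case/andP=> pt lt ->; rewrite /forest /= pt /fleaves /= addn0 lt.
case: t => g /andP[pt /eqP lt] -> /=.
by rewrite -lt; apply: avoiding_Node => //; apply: contraTN n_gt1 => /eqP g0; rewrite -lt g0.
Qed.

Lemma avoiding_forests_mono n : sg n <= sg n.+1.
Proof.
apply: (@size_inj_le _ _ (fins leaf)); first exact: forests_uniq.
  move=> f g; rewrite !mem_forests; try exact: avoiding_canon.
  by case/and3P=> sf _ _ /and3P[sg' _ _]; apply: fins_inj.
move=> f; rewrite !mem_forests; try exact: avoiding_canon.
exact: (forest_fins avoiding_leaf).
Qed.

Lemma fins_size t f : size (fins t f) = (size f).+1.
Proof. by rewrite size_sort. Qed.

(** Add a leaf to the forest and put a root on top: there are at least two children, and the size
    condition keeps the result from being [M]. *)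
Lemma avoiding_forests_le_trees n : 0 < n -> n.+1 != m -> sg n <= s n.+1.
Proof.
move=> n_gt0 nm; apply: (@size_inj_le _ _ (fun f => Node (fins leaf f))).
- exact: forests_uniq.
- move=> f g; rewrite !mem_forests; try exact: avoiding_canon.
  by case/and3P=> sf _ _ /and3P[sg' _ _] [] /fins_inj; apply.
move=> f; rewrite mem_forests ?mem_trees; try exact: avoiding_canon.
move=> ff; have ff' := forest_fins avoiding_leaf ff.
have f_n0 := forest_size ff n_gt0.
have lf : leaves (Node (fins leaf f)) = n.+1.
  rewrite leaves_Node; first by case/and3P: ff' => _ _ /eqP.
  by rewrite -size_eq0 fins_size.
rewrite lf eqxx andbT; apply: (Node_avoiding ff').
  by rewrite fins_size eqSS size_eq0.
by apply: contraNneq nm => E; rewrite -lf E.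
Qed.

Lemma avoiding_trees_gt0 n : 0 < n -> 0 < s n.
Proof.
(* The value 2, propagated by monotonicity, leaves [s n] positive even at [n = m], where the upper
   bound on [sg n] has an extra 1. *)
have sg2 : 2 <= sg 2.
  have := avoiding_forests_mono 1; have := @avoiding_forests_le_trees 1 isT; have := @avoiding_forests_ge 2 isT.
  have -> : 2 != m by rewrite neq_ltn M_leaves.
  have : 0 < sg 1.
    have : [:: leaf] \in forests avoiding 1.
      rewrite mem_forests; last exact: avoiding_canon.
      by rewrite /forest /= avoiding_leaf.
    by rewrite /sg; case: (forests _ _).
  lia.
case: n => [//|[_|n _]].
  have : leaf \in trees avoiding 1.
    by rewrite mem_trees ?avoiding_leaf //; exact: avoiding_canon.
  by rewrite /s; case: (trees _ _).
have : sg 2 <= sg n.+2 by elim: n => // n IH; apply: leq_trans IH (avoiding_forests_mono _).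
have := @avoiding_forests_le n.+2 isT; lia.
Qed.

Lemma containing_trees_gt0 : 0 < u m.
Proof.
have : M \in trees containing m.
  rewrite mem_trees; last exact: containing_canon.
  by rewrite eqxx andbT /containing M_canon; case: M => f /=; rewrite eqxx.
by rewrite /u; case: (trees _ _).
Qed.

(** The inserted tree is recognisable as the only one in the forest that contains [M]. *)
Lemma fins_containing_inj c c' f f' :
  containing c -> containing c' -> all avoiding f -> all avoiding f' ->
  fins c f = fins c' f' -> c = c'.
Proof.
move=> cc cc' af af' E.
have : c \in c' :: f'.
  by rewrite -(perm_mem (fins_perm c' f')) -E (perm_mem (fins_perm c f)) mem_head.
rewrite inE => /orP[/eqP //|/(allP af')].
by case/andP=> _; case/andP: cc => _ ->.
Qed.

(** Graft a containing tree of size [j] and an avoiding forest of size [n - j] under a common root;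
    both parts can be recovered from the result. *)
Lemma containing_trees_rec n : m < n -> \sum_(m <= j < n) sg (n - j) * u j <= u n.
Proof.
move=> n_gt.
pose C := [seq c | j <- index_iota m n, c <- trees containing j].
pose L := [seq (c, f) | c <- C, f <- forests avoiding (n - leaves c)].
have LP x : x \in L -> [/\ containing x.1, leaves x.1 < n & forest avoiding (n - leaves x.1) x.2].
  case/allpairsPdep => c [f [/allpairsPdep[j [c' [jn]]]]].
  rewrite mem_trees => [/andP[cc /eqP lc] ->|]; last exact: containing_canon.
  rewrite mem_forests => [ff -> /=|]; last exact: avoiding_canon.
  by split=> //; move: jn; rewrite mem_index_iota lc => /andP[].
have -> : \sum_(m <= j < n) sg (n - j) * u j = size L.
  rewrite -sum1_size big_allpairs_dep big_allpairs_dep; apply: eq_bigr => j _.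
  rewrite mulnC /u -sum1_size big_distrl /= big_seq [RHS]big_seq.
  apply: eq_bigr => c; rewrite mem_trees => [/andP[_ /eqP ->]|]; last exact: containing_canon.
  by rewrite sum1_size mul1n.
apply: (@size_inj_le _ _ (fun x => Node (fins x.1 x.2))).
- apply: allpairs_uniq_dep => /=.
  + apply: allpairs_uniq_dep; rewrite ?iota_uniq //=; first by move=> *; exact: trees_uniq.
    move=> [j c] [j' c'] /allpairsPdep[j1 [c1 [_ +]]] + /allpairsPdep[j2 [c2 [_ +]]].
    rewrite !mem_trees; try exact: containing_canon.
    move=> /andP[_ /eqP <-] E1 /andP[_ /eqP <-] E2 /= cc.
    have := congr1 (fun x => (tagged x : tree)) E1; have := congr1 (fun x => (tagged x : tree)) E2.
    by move=> /= e2 e1; rewrite E1 E2 -e1 -e2 cc.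
  + by move=> *; exact: forests_uniq.
  + by move=> [c f] [c' f'] _ _ /= [-> ->].
- move=> [c f] [c' f'] /LP[/= cc _ ff] /LP[/= cc' _ ff'] [] E.
  have cE : c = c'.
    by apply: fins_containing_inj E => //; [case/and3P: ff | case/and3P: ff'].
  by move: E; rewrite cE => /fins_inj -> //; [case/and3P: ff | case/and3P: ff'].
move=> [c f] /LP[/= cc cn ff]; rewrite mem_trees; last exact: containing_canon.
have f_n0 : f != [::] by apply: forest_size ff _; lia.
have ff' : forest canon (leaves c + (n - leaves c)) (fins c f).
  apply: forest_fins; first exact: containing_canon.
  case/and3P: ff => sf af lf; rewrite /forest sf lf andbT /=.
  exact: sub_all avoiding_canon _ af.
have lf : leaves (Node (fins c f)) = n.
  rewrite leaves_Node; first by case/and3P: ff' => _ _ /eqP ->; lia.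
  by rewrite -size_eq0 fins_size.
rewrite lf eqxx andbT /containing (canon_Node _ ff') //=; last first.
  by rewrite fins_size eqSS size_eq0.
apply/orP; right; apply/hasP; exists c; last by case/andP: cc.
by rewrite (perm_mem (fins_perm _ _)) mem_head.
Qed.

Lemma containing_dominates : exists G, forall A, exists N, forall n, N <= n ->
  A * sg n <= G * u n.
Proof.
have [G HG] : exists G, forall A, exists N, forall n, N <= n -> A * s n <= G * u n.
  apply: (@u_dominates_s m s sg u (occ avoiding)).
  - by rewrite /m; lia.
  - by rewrite /sg forests0.
  - exact: avoiding_trees_gt0.
  - by move=> n; apply: trees_le_forests; exact: avoiding_canon.
  - move=> n n_gt0; have := avoiding_forests_le n_gt0; have := avoiding_trees_gt0 n_gt0.
    by case: (n == m) => /=; lia.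
  - move=> n n_gt; have := @avoiding_forests_le n; have := @avoiding_forests_ge n.
    have -> : (n == m) = false by lia.
    by move: n_gt M_leaves; rewrite /m; lia.
  - by move=> n n_ge; apply: avoiding_forests_le_trees; move: n_ge M_leaves; rewrite /m; lia.
  - exact: avoiding_forests_mono.
  - by move=> n; apply: occ_sum; exact: avoiding_canon.
  - by move=> n k; apply: occ_rec; exact: avoiding_canon.
  - by move=> n k; apply: occ_0; exact: avoiding_canon.
  - exact: containing_trees_gt0.
  - exact: containing_trees_rec.
(* The factor 3 pays for replacing [s n] by [sg n]. *)
exists G => A; have [N HN] := HG (3 * A); exists N.+1 => n n_ge.
have := HN n ltac:(lia); have := @avoiding_forests_le n ltac:(lia).
have := avoiding_trees_gt0 (n := n) ltac:(lia); case: (n == m) => /=; nia.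
Qed.

End Avoiding.

(** * Graphs of trees *)

(** Arbitrary finite vertex types let disjoint unions live on sum types, away from the index
    arithmetic of ['I_(m + k)]. *)
Record fgraph := FGraph { vtx :> finType; adj : rel vtx }.
Arguments adj : clear implicits.

Definition giso (X Y : fgraph) : Prop :=
  exists2 f : X -> Y, bijective f & forall x y, adj Y (f x) (f y) = adj X x y.

Definition gK1 := @FGraph unit (fun _ _ => false).
Definition g0 := @FGraph void (fun _ _ => false).
Definition gcompl (X : fgraph) :=
  @FGraph X (fun x y => (x != y) && ~~ adj X x y).
Definition gsum (X Y : fgraph) :=
  @FGraph (X + Y)%type (fun p q => match p, q with
    | inl a, inl b => adj X a b
    | inr a, inr b => adj Y a b
    | _, _ => false end).

Definition gsimple (X : fgraph) := symmetric (adj X) /\ irreflexive (adj X).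

(* Taking a complement at every inner node makes the union and join labels of
   the cotree alternate, so they need not be recorded. *)
Fixpoint gT (t : tree) : fgraph :=
  let: Node s := t in
  if s is [::] then gK1 else gcompl (foldr (fun c X => gsum (gT c) X) g0 s).

Definition gF (f : seq tree) : fgraph := foldr (fun c X => gsum (gT c) X) g0 f.

Lemma gT_Node s : s != [::] -> gT (Node s) = gcompl (gF s).
Proof. by case: s. Qed.

Lemma giso_refl X : giso X X.
Proof. by exists id => //; exists id. Qed.

Lemma giso_sym X Y : giso X Y -> giso Y X.
Proof.
case=> f [g fK gK] fA; exists g; first by exists f.
by move=> x y; rewrite -fA !gK.
Qed.

Lemma giso_trans Y X Z : giso X Y -> giso Y Z -> giso X Z.
Proof.
case=> f fb fA [g gb gA]; exists (g \o f); first exact: bij_comp.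
by move=> x y; rewrite /= gA fA.
Qed.

Lemma giso_card X Y : giso X Y -> #|X| = #|Y|.
Proof. by case=> f fb _; exact: bij_eq_card fb. Qed.

Lemma giso_compl X Y : giso X Y -> giso (gcompl X) (gcompl Y).
Proof.
by case=> f fb fA; exists f => // x y; rewrite /= fA (bij_eq fb).
Qed.

Lemma gcomplK X : irreflexive (adj X) -> giso (gcompl (gcompl X)) X.
Proof.
move=> irr; exists id; first by exists id.
by move=> x y /=; case: eqVneq => [->|_] /=; rewrite ?irr ?negbK.
Qed.

Lemma giso_sum X X' Y Y' : giso X X' -> giso Y Y' -> giso (gsum X Y) (gsum X' Y').
Proof.
case=> f [f' fK fK'] fA [g [g' gK gK'] gA].
exists (fun p : gsum X Y => match p with inl a => inl (f a) | inr b => inr (g b) end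
        : gsum X' Y'); last by case=> a [] b /=.
exists (fun p => match p with inl a => inl (f' a) | inr b => inr (g' b) end).
  by case=> a; rewrite ?fK ?gK.
by case=> a; rewrite ?fK' ?gK'.
Qed.

Lemma gsumC X Y : giso (gsum X Y) (gsum Y X).
Proof.
exists (fun p : gsum X Y => match p with inl a => inr a | inr b => inl b end : gsum Y X).
  by exists (fun p => match p with inl a => inr a | inr b => inl b end); case.
by case=> a [].
Qed.

Lemma gsumA X Y Z : giso (gsum X (gsum Y Z)) (gsum (gsum X Y) Z).
Proof.
exists (fun p : gsum X (gsum Y Z) => match p with
   | inl a => inl (inl a) | inr (inl b) => inl (inr b) | inr (inr c) => inr c end
   : gsum (gsum X Y) Z).
  exists (fun p => match p with
    | inl (inl a) => inl a | inl (inr b) => inr (inl b) | inr c => inr (inr c) end).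
    by case=> [a|[b|c]].
  by case=> [[a|b]|c].
by case=> [a|[b|c]] [a'|[b'|c']].
Qed.

Lemma gsum0 X : giso (gsum X g0) X.
Proof.
exists (fun p : gsum X g0 => match p with inl a => a | inr b => match b with end end : X).
  by exists inl => //; case=> // -[].
by case=> // a [] // [].
Qed.

Lemma gF_cat f g : giso (gF (f ++ g)) (gsum (gF f) (gF g)).
Proof.
elim: f => [|c f IH] /=; first exact: giso_trans (giso_sym (gsum0 _)) (gsumC _ _).
exact: giso_trans (giso_sum (giso_refl _) IH) (gsumA _ _ _).
Qed.

Lemma gF_perm f g : perm_eq f g -> giso (gF f) (gF g).
Proof.
move=> fg; apply: (@catCA_perm_ind _ (fun g => giso (gF f) (gF g)) _ f) fg (giso_refl _).
move=> s1 s2 s3 H; apply: giso_trans H _.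
have step a b : giso (gF (a ++ b ++ s3)) (gsum (gsum (gF a) (gF b)) (gF s3)).
  rewrite catA; apply: giso_trans (gF_cat _ _) _.
  exact: giso_sum (gF_cat _ _) (giso_refl _).
apply: giso_trans (step _ _) (giso_trans _ (giso_sym (step _ _))).
exact: giso_sum (gsumC _ _) (giso_refl _).
Qed.

Lemma gsimple_K1 : gsimple gK1. Proof. by []. Qed.

Lemma gsimple_compl X : gsimple X -> gsimple (gcompl X).
Proof.
by case=> sX _; split=> [x y|x] /=; rewrite ?eqxx // eq_sym sX.
Qed.

Lemma gsimple_sum X Y : gsimple X -> gsimple Y -> gsimple (gsum X Y).
Proof.
by case=> sX iX [sY iY]; split=> [[a|a] [b|b]|[a|a]] /=; rewrite ?iX ?iY // ?(sX a) ?(sY a).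
Qed.

Lemma gsimple_F f : {in f, forall t, gsimple (gT t)} -> gsimple (gF f).
Proof.
elim: f => [_|c f IH H] /=; first by split=> -[].
by apply: gsimple_sum; [apply: H; rewrite mem_head | apply: IH => t tf; apply: H; rewrite inE tf orbT].
Qed.

Lemma gsimple_T t : gsimple (gT t).
Proof.
elim/tree_ind_mem: t => s IH; have [->|s_n0] := eqVneq s [::]; first exact: gsimple_K1.
by rewrite gT_Node //; apply: gsimple_compl; apply: gsimple_F.
Qed.

Lemma gsimple_gF f : gsimple (gF f).
Proof. by apply: gsimple_F => t _; exact: gsimple_T. Qed.

Lemma card_gsum (X Y : fgraph) : #|gsum X Y| = #|X| + #|Y|.
Proof. exact: card_sum. Qed.

Lemma card_gT t : #|gT t| = leaves t.
Proof.
elim/tree_ind_mem: t => s IH; have [->|s_n0] := eqVneq s [::]; first exact: card_unit.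
rewrite gT_Node // leaves_Node // [LHS]/=.
elim: s {s_n0} IH => [|c s IHs] IH; first by rewrite /= card_void.
rewrite [LHS]card_gsum IH ?mem_head // IHs // => t ts.
by apply: IH; rewrite inE ts orbT.
Qed.

Lemma card_gF f : #|gF f| = fleaves f.
Proof.
elim: f => [|c f IH]; first by rewrite /= card_void.
by rewrite [LHS]card_gsum IH card_gT.
Qed.

(** * A canonical tree is determined by its graph *)

Section Injectivity.

Definition gconn (X : fgraph) := 0 < #|X| /\
  forall S : pred X, (forall x y, S x -> adj X x y -> S y) ->
  forall x y, S x -> S y.

(* For connected [H] this set has [|Aut H|] elements for every component of [X]
   isomorphic to [H], so its cardinal recovers the multiset of components. *)
Definition gemb (H X : fgraph) : {set {ffun H -> X}} :=
  [set f : {ffun H -> X} | [&& injectiveb f,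
    [forall x, forall y, adj X (f x) (f y) == adj H x y] &
    [forall x, forall z, adj X (f x) z ==> (z \in codom f)]]].

Lemma gembP (H X : fgraph) (f : {ffun H -> X}) :
  reflect [/\ injective f, forall x y, adj X (f x) (f y) = adj H x y &
     forall x z, adj X (f x) z -> exists y, z = f y] (f \in gemb H X).
Proof.
rewrite inE; apply: (iffP and3P) => [[/injectiveP fi fA fc]|[fi fA fc]]; split=> //.
- by move=> x y; apply/eqP; move/forallP: fA => /(_ x) /forallP.
- by move=> x z xz; move/forallP: fc => /(_ x) /forallP /(_ z) /implyP /(_ xz) /codomP.
- exact/injectiveP.
- by apply/forallP => x; apply/forallP => y; rewrite fA.
- by apply/forallP => x; apply/forallP => z; apply/implyP => /fc /codomP.
Qed.

Lemma gemb_le_giso H X Y : giso X Y -> #|gemb H X| <= #|gemb H Y|.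
Proof.
case=> f [g fK gK] fA.
pose comp (h : {ffun H -> X}) : {ffun H -> Y} := [ffun x => f (h x)].
rewrite -(card_imset (f := comp)); last first.
  move=> h h' /ffunP E; apply/ffunP => x; apply: (can_inj fK).
  by have := E x; rewrite !ffunE.
apply/subset_leq_card/subsetP => _ /imsetP[h /gembP[hi hA hc] ->].
apply/gembP; split.
- by move=> x y; rewrite !ffunE => /(can_inj fK) /hi.
- by move=> x y; rewrite !ffunE fA hA.
move=> x z; rewrite ffunE -[z]gK fA => /hc[y ->]; exists y; by rewrite ffunE.
Qed.

Lemma gemb_giso H X Y : giso X Y -> #|gemb H X| = #|gemb H Y|.
Proof.
by move=> XY; apply/eqP; rewrite eqn_leq !gemb_le_giso //; apply: giso_sym.
Qed.

(** The vertices of [H] sent into one summand form a set closed under adjacency, so a connected [H]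
    lands entirely on one side. *)
Lemma gemb_sum H X Y : gconn H -> #|gemb H (gsum X Y)| = #|gemb H X| + #|gemb H Y|.
Proof.
case=> /card_gt0P[h0 _] Hc.
pose l (h : {ffun H -> X}) : {ffun H -> gsum X Y} := [ffun x => inl (h x)].
pose r (h : {ffun H -> Y}) : {ffun H -> gsum X Y} := [ffun x => inr (h x)].
have li : injective l.
  by move=> h h' /ffunP E; apply/ffunP => x; have := E x; rewrite !ffunE => -[].
have ri : injective r.
  by move=> h h' /ffunP E; apply/ffunP => x; have := E x; rewrite !ffunE => -[].
rewrite -(card_imset _ li) -(card_imset (gemb H Y) ri) -cardsUI.
rewrite [X in _ = _ + X]eq_card0 ?addn0; last first.
  move=> h; rewrite inE; apply/andP => -[/imsetP[a _ ->] /imsetP[b _ /ffunP /(_ h0)]].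
  by rewrite !ffunE.
apply: eq_card => h; rewrite in_setU; apply/idP/orP; last first.
  case=> /imsetP[k /gembP[ki kA kc] ->]; apply/gembP; split.
  - by move=> x y; rewrite !ffunE => -[] /ki.
  - by move=> x y; rewrite !ffunE /= kA.
  - by move=> x [z|z]; rewrite !ffunE //= => /kc[y ->]; exists y; rewrite ffunE.
  - by move=> x y; rewrite !ffunE => -[] /ki.
  - by move=> x y; rewrite !ffunE /= kA.
  - by move=> x [z|z]; rewrite !ffunE //= => /kc[y ->]; exists y; rewrite ffunE.
move=> /gembP[hi hA hc]; case E0 : (h h0) => [a0|b0]; [left|right].
- have side x : exists a, h x = inl a.
    pose S x := if h x is inl _ then true else false.
    have := Hc S _ h0 x; rewrite /S E0 => /(_ _ isT).
    case: (h x) => [a _|b H']; first by exists a.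
    by suff: false by []; apply: H' => y z; rewrite -hA; case: (h y); case: (h z).
  (* The default [a0] is never reached, by [side]. *)
  pose k := [ffun x => if h x is inl a then a else a0].
  have hk : h = l k.
    by apply/ffunP => x; rewrite !ffunE; have [a ->] := side x.
  clearbody k.
  apply/imsetP; exists k => //; apply/gembP; split.
  + by move=> x y E; apply: hi; rewrite hk !ffunE E.
  + by move=> x y; rewrite -hA hk !ffunE.
  + move=> x z xz; have := hc x (inl z); rewrite hk [l k x]ffunE /= => /(_ xz)[y].
    by rewrite ffunE => -[->]; exists y.
- have side x : exists b, h x = inr b.
    pose S x := if h x is inr _ then true else false.
    have := Hc S _ h0 x; rewrite /S E0 => /(_ _ isT).
    case: (h x) => [a H'|b _]; last by exists b.
    by suff: false by []; apply: H' => y z; rewrite -hA; case: (h y); case: (h z).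
  pose k := [ffun x => if h x is inr b then b else b0].
  have hk : h = r k.
    by apply/ffunP => x; rewrite !ffunE; have [b ->] := side x.
  clearbody k.
  apply/imsetP; exists k => //; apply/gembP; split.
  + by move=> x y E; apply: hi; rewrite hk !ffunE E.
  + by move=> x y; rewrite -hA hk !ffunE.
  + move=> x z xz; have := hc x (inr z); rewrite hk [r k x]ffunE /= => /(_ xz)[y].
    by rewrite ffunE => -[->]; exists y.
Qed.

Lemma gemb_g0 (H : fgraph) : 0 < #|H| -> #|gemb H g0| = 0.
Proof. by case/card_gt0P=> h _; apply: eq_card0 => f; case: (f h). Qed.

(** The image of an embedding is nonempty and closed under adjacency, hence all of the connected
    graph [X]. *)
Lemma gemb_conn H X : gconn H -> gconn X -> 0 < #|gemb H X| -> giso H X.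
Proof.
case=> /card_gt0P[h0 _] _ [_ Xc] /card_gt0P[f /gembP[fi fA fc]].
have fs x : exists y, x = f y.
  have := Xc (mem (codom f)) _ (f h0) x; rewrite /= codom_f => /(_ _ isT) H'.
  apply/codomP/H' => y z /codomP[y' ->] /fc[z' ->]; exact: codom_f.
exists f => //; apply: inj_card_bij => //.
have <- : #|codom f| = #|X|.
  by apply: eq_card => x; rewrite !inE; apply/codomP.
by rewrite card_codom.
Qed.

Lemma gemb_self H : 0 < #|gemb H H|.
Proof.
apply/card_gt0P; exists [ffun x => x]; apply/gembP; split.
- by move=> x y; rewrite !ffunE.
- by move=> x y; rewrite !ffunE.
- by move=> x z _; exists z; rewrite ffunE.
Qed.

(** The complement joins every vertex of [X] to every vertex of [Y], so any two vertices are at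
    distance at most two. *)
Lemma gconn_compl_sum (X Y : fgraph) : 0 < #|X| -> 0 < #|Y| -> gconn (gcompl (gsum X Y)).
Proof.
case/card_gt0P=> a0 _ /card_gt0P[b0 _]; split.
  by apply/card_gt0P; exists (inl a0).
move=> S Sc x y Sx.
have Sl a : S (inl a) -> forall b, S (inr b) by move=> Sa b; apply: Sc Sa _.
have Sr b : S (inr b) -> forall a, S (inl a) by move=> Sa a; apply: Sc Sa _.
by case: x Sx => [a /Sl|b /Sr] H; case: y => [a'|b'] //; [apply: (Sr b0)|apply: (Sl a0)].
Qed.

Lemma gconn_T t : canon t -> gconn (gT t).
Proof.
case: t => -[|c [|d s]] //= _.
  by split=> [|S _ [] []]; rewrite ?card_unit.
apply: gconn_compl_sum; rewrite ?card_gT ?leaves_gt0 //.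
by rewrite [#|_|]card_gsum card_gT addn_gt0 leaves_gt0.
Qed.

(** Injectivity is assumed only for the trees at hand, because it will be supplied by the induction
    hypothesis of [gT_inj]. *)
Lemma gemb_F t f : canon t -> all canon f ->
  {in f, forall c, giso (gT t) (gT c) -> t = c} ->
  #|gemb (gT t) (gF f)| = count_mem t f * #|gemb (gT t) (gT t)|.
Proof.
move=> ct; elim: f => [|c f IH] /=.
  by rewrite gemb_g0 // card_gT leaves_gt0.
case/andP=> cc cf H; rewrite gemb_sum; last exact: gconn_T.
rewrite IH //; last by move=> d df; apply: H; rewrite inE df orbT.
rewrite mulnDl; congr (_ + _); case: eqP => [-> /=|ct_neq]; first by rewrite mul1n.
rewrite mul0n; apply/eqP; rewrite -leqn0 leqNgt; apply/negP => /gemb_conn-/(_ (gconn_T ct)).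
by move=> /(_ (gconn_T cc)) /H E; apply: ct_neq; rewrite E ?mem_head.
Qed.

(** Counting embeddings of [gT t] on both sides and cancelling the positive factor
    [#|gemb (gT t) (gT t)|] shows that [t] has the same multiplicity in [f] and [g]. *)
Lemma gF_inj f g : sorted leT f -> sorted leT g -> all canon f -> all canon g ->
  {in f ++ g &, forall c d, giso (gT c) (gT d) -> c = d} ->
  giso (gF f) (gF g) -> f = g.
Proof.
move=> sf sg cf cg H fg; apply: (sorted_eq leT_trans leT_anti) => //.
apply/allP => t tfg /=.
have ct : canon t by move: tfg; rewrite mem_cat => /orP[/(allP cf)|/(allP cg)].
have := gemb_giso (gT t) fg.
rewrite !gemb_F //; try by move=> c c_in; apply: H => //; rewrite mem_cat c_in ?orbT.
by move/eqP; rewrite eqn_mul2r => /orP[/eqP E|//]; have := gemb_self (gT t); rewrite E.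
Qed.

(** Complementing both graphs strips the roots and leaves two isomorphic forests of trees with fewer
    leaves. *)
Lemma gT_inj t t' : canon t -> canon t' -> giso (gT t) (gT t') -> t = t'.
Proof.
have [n] := ubnP (leaves t); elim: n t t' => // n IH [s] [s'].
have canon_le1 r : canon (Node r) -> leaves (Node r) <= 1 -> r = [::].
  have [->//|r_n0] := eqVneq r [::]; rewrite leaves_Node // => /and3P[r1 _ _].
  have := size_le_fleaves r; case: r r1 r_n0 => [|x [|y r]] //= _ _; lia.
move=> lt ct ct' iso; have lE := giso_card iso; rewrite !card_gT in lE.
have [s0|s_n0] := eqVneq s [::].
  by rewrite s0 (@canon_le1 s') // -lE s0.
have s'_n0 : s' != [::].
  by apply: contra_neq s_n0 => s'0; apply: canon_le1 => //; rewrite lE s'0.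
case/and3P: (ct) => s1 ss cs; case/and3P: (ct') => s1' ss' cs'.
congr Node; apply: gF_inj => //; last first.
  rewrite !gT_Node // in iso.
  apply: giso_trans (giso_trans (giso_compl iso) (gcomplK _)); last by case: (gsimple_gF s').
  by apply/giso_sym/gcomplK; case: (gsimple_gF s).
have small r c : canon (Node r) -> leaves (Node r) < n.+1 -> c \in r -> leaves c < n.
  move=> cr; have [->//|r_n0] := eqVneq r [::]; rewrite leaves_Node // => lr cr'.
  have : leaves c + (size r).-1 <= fleaves r := fleaves_mem cr'.
  by case/and3P: cr => r1 _ _; case: r r1 r_n0 lr {cr'} => [|x [|y r]] //= _ _; lia.
move=> c d; rewrite !mem_cat => c_in d_in; apply: IH.
- by case/orP: c_in; apply: small => //; rewrite -lE.
- by case/orP: c_in => [/(allP cs)|/(allP cs')].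
- by case/orP: d_in => [/(allP cs)|/(allP cs')].
Qed.

End Injectivity.

(** * Cospectral mates *)

Definition hasP4 (X : fgraph) : Prop := exists a b c d : X,
  [/\ adj X a b, adj X b c & adj X c d] /\ [/\ ~~ adj X a c, ~~ adj X a d & ~~ adj X b d].

Lemma hasP4_giso X Y : giso X Y -> hasP4 X -> hasP4 Y.
Proof.
case=> f _ fA [a [b [c [d H]]]]; exists (f a), (f b), (f c), (f d).
by rewrite !fA.
Qed.

Lemma P4_neq (X : fgraph) (a b c d : X) : gsimple X ->
  [/\ adj X a b, adj X b c & adj X c d] -> [/\ ~~ adj X a c, ~~ adj X a d & ~~ adj X b d] ->
  [/\ a != b, b != c & c != d] /\ [/\ a != c, a != d & b != d].
Proof.
case=> sX iX [ab bc cd] [ac ad bd]; split; split.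
- by apply: contraTneq ab => ->; rewrite iX.
- by apply: contraTneq bc => ->; rewrite iX.
- by apply: contraTneq cd => ->; rewrite iX.
- by apply: contraNneq ad => ->.
- by apply: contraNneq bd => <-; rewrite sX.
- by apply: contraNneq ad => <-.
Qed.

(** The path on four vertices is self-complementary: [a, b, c, d] becomes [b, d, a, c]. *)
Lemma hasP4_compl X : gsimple X -> hasP4 X -> hasP4 (gcompl X).
Proof.
move=> gX [a [b [c [d [p q]]]]]; have [[ab bc cd] [ac ad bd]] := P4_neq gX p q.
case: gX => sX iX; case: p q => [p1 p2 p3] [q1 q2 q3].
exists b, d, a, c; rewrite /= bd (eq_sym d) ad ac (sX d a) (sX b a) (sX d c).
by rewrite q1 q2 q3 p1 p2 p3 !andbF.
Qed.

Lemma hasP4_compl_inv X : gsimple X -> hasP4 (gcompl X) -> hasP4 X.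
Proof.
move=> gX H; have [_ iX] := gX.
exact: hasP4_giso (gcomplK iX) (hasP4_compl (gsimple_compl gX) H).
Qed.

Lemma hasP4_suml X Y : hasP4 X -> hasP4 (gsum X Y).
Proof. by case=> a [b [c [d H]]]; exists (inl a), (inl b), (inl c), (inl d). Qed.

Lemma hasP4_sum X Y : hasP4 (gsum X Y) -> hasP4 X \/ hasP4 Y.
Proof.
case=> -[a|a] [[b|b]] [[c|c]] [[d|d]] [] [] //= *; [left|right]; by exists a, b, c, d.
Qed.

Local Open Scope ring_scope.

Definition adjC (X : fgraph) (x y : X) : algC := (adj X x y)%:R.
Arguments adjC : clear implicits.

(* [Q] is an orthogonal matrix with all row and column sums equal to 1 which
   conjugates the adjacency matrix of [X] into that of [e]; such a conjugation
   survives both complementation and disjoint union. *)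
Definition gmate (X : fgraph) : Prop := exists (e : rel X) (Q : X -> X -> algC),
  [/\ gsimple (FGraph e), hasP4 (FGraph e),
      (forall x, \sum_y Q x y = 1), (forall y, \sum_x Q x y = 1) &
      (forall x y, \sum_z Q x z * Q y z = (x == y)%:R) /\
      (forall x y, \sum_z adjC X x z * Q z y = \sum_z Q x z * adjC (FGraph e) z y)].

Lemma sum_delta (X : finType) (x : X) (F : X -> algC) :
  \sum_z (x == z)%:R * F z = F x.
Proof.
rewrite (bigD1 x) //= eqxx mul1r big1 ?addr0 // => z.
by rewrite eq_sym => /negPf ->; rewrite mul0r.
Qed.

Lemma adjC_compl (X : fgraph) (x y : X) : irreflexive (adj X) ->
  adjC (gcompl X) x y = 1 - (x == y)%:R - adjC X x y.
Proof.
rewrite /adjC /= => iX; case: eqVneq => [->|_]; first by rewrite iX !subrr.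
by case: (adj X x y); rewrite /= ?subr0 ?subrr.
Qed.

(** The complement has matrix [J - I - A] with [J] the all-ones matrix, and [Q] commutes with [J]
    because its row and column sums are 1. *)
Lemma gmate_compl X : gsimple X -> gmate X -> gmate (gcompl X).
Proof.
case=> _ iX [e [Q [ge pe rs cs [orth tw]]]]; have [_ ie] := ge.
exists (adj (gcompl (FGraph e))), Q; split=> //.
- exact: (gsimple_compl ge).
- exact: (hasP4_compl ge pe).
split=> // x y.
transitivity (\sum_z (Q z y - (x == z)%:R * Q z y - adjC X x z * Q z y)).
  by apply: eq_bigr => z _; rewrite adjC_compl // !mulrBl mul1r.
rewrite !sumrB sum_delta cs tw.
transitivity (\sum_z (Q x z - (y == z)%:R * Q x z - Q x z * adjC (FGraph e) z y)).
  by rewrite !sumrB sum_delta rs.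
apply: eq_bigr => z _; rewrite (@adjC_compl (FGraph e)) // !mulrBr mulr1 (eq_sym z).
by rewrite (mulrC (Q x z) (_ == _)%:R).
Qed.

Lemma gmate_giso X Y : giso X Y -> gmate X -> gmate Y.
Proof.
case=> f fb fA [e [Q [[se ie] pe rs cs [orth tw]]]]; case: (fb) => g fK gK.
have gb : bijective g by exists f.
exists (fun x y => e (g x) (g y)), (fun x y => Q (g x) (g y)); split.
- by split=> [x y|x] /=; [exact: se | exact: ie].
- by apply: hasP4_giso pe; exists f => // x y /=; rewrite !fK.
- by move=> x; rewrite -(rs (g x)) [RHS](reindex g) //; exact: onW_bij.
- by move=> y; rewrite -(cs (g y)) [RHS](reindex g) //; exact: onW_bij.
split=> x y.
  by rewrite -(bij_eq gb) -orth [RHS](reindex g) //; exact: onW_bij.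
have := tw (g x) (g y); rewrite [LHS](reindex g) ?[RHS](reindex g) /=; try exact: onW_bij.
move=> <-; apply: eq_bigr => z _; congr (_ * _).
by rewrite /adjC -fA !gK.
Qed.

(** Extend [Q] by the identity block on [Y]. *)
Lemma gmate_sum X Y : gsimple Y -> gmate X -> gmate (gsum X Y).
Proof.
move=> gY [e [Q [ge pe rs cs [orth tw]]]].
pose R (p q : gsum X Y) : algC := match p, q with
  | inl a, inl b => Q a b | inr a, inr b => (a == b)%:R | _, _ => 0 end.
exists (adj (gsum (FGraph e) Y)), R.
have dr (a : Y) (F : Y -> algC) : \sum_z F z * (z == a)%:R = F a.
  by rewrite -[RHS]sum_delta; apply: eq_bigr => z _; rewrite mulrC eq_sym.
have d1 (a : Y) : \sum_z (a == z)%:R = 1 :> algC.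
  by rewrite -[RHS](sum_delta a (fun=> 1)); apply: eq_bigr => z _; rewrite mulr1.
split.
- exact: (gsimple_sum ge gY).
- exact: (hasP4_suml Y pe).
- move=> [a|a]; rewrite big_sumType /=; first by rewrite rs big1 ?addr0.
  by rewrite big1 ?add0r.
- move=> [a|a]; rewrite big_sumType /=; first by rewrite cs big1 ?addr0.
  by rewrite big1 ?add0r //; rewrite -[RHS](d1 a); apply: eq_bigr => z _; rewrite eq_sym.
split=> -[a|a] [b|b]; rewrite ?big_sumType /=.
- by rewrite orth big1 ?addr0 // => z _; rewrite mulr0.
- by rewrite /adjC /= !big1 ?addr0 // => z _; rewrite ?mulr0n ?mulr0 ?mul0r.
- by rewrite /adjC /= !big1 ?addr0 // => z _; rewrite ?mulr0n ?mulr0 ?mul0r.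
- rewrite big1 ?add0r; last by move=> z _; rewrite mulr0.
  by rewrite sum_delta eq_sym.
- have := tw a b; rewrite /adjC /= => ->; congr (_ + _).
  by rewrite !big1 // => z _; rewrite ?mulr0n ?mulr0 ?mul0r.
- by rewrite /adjC /= !big1 ?addr0 // => z _; rewrite ?mulr0n ?mulr0 ?mul0r.
- rewrite big1 ?add0r => [|z _]; last by rewrite mulr0.
  by rewrite /adjC /= dr sum_delta.
Qed.

Lemma gmate_mem c f : c \in f -> gmate (gT c) -> gmate (gF f).
Proof.
move=> cf mc; apply: (gmate_giso (giso_sym (gF_perm (perm_to_rem cf)))).
by apply: gmate_sum => //; exact: gsimple_gF.
Qed.

Lemma gmate_T M t : gmate (gT M) -> has_sub M t -> gmate (gT t).
Proof.
move=> mM; elim/tree_ind_mem: t => s IH.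
rewrite [has_sub _ _]/= => /orP[/eqP -> //|/hasP[c cs Mc]].
rewrite gT_Node; last by case: s cs {IH}.
apply: gmate_compl; first exact: gsimple_gF.
exact: gmate_mem cs (IH _ cs Mc).
Qed.

(** * Cographs and canonical forests *)

Definition rep (X : fgraph) : Prop := exists f,
  [/\ f != [::], sorted leT f, all canon f & giso X (gF f)].

Lemma rep_giso X Y : giso X Y -> rep Y -> rep X.
Proof. by move=> XY [f [f0 sf cf Yf]]; exists f; split=> //; exact: giso_trans Yf. Qed.

Lemma rep_K1 : rep gK1.
Proof. by exists [:: leaf]; split=> //; exact: giso_sym (gsum0 _). Qed.

Lemma rep_sum X Y : rep X -> rep Y -> rep (gsum X Y).
Proof.
case=> f [f0 sf cf Xf] [g [g0' sg cg Yg]]; exists (sort leT (f ++ g)).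
have fg : perm_eq (sort leT (f ++ g)) (f ++ g) by rewrite perm_sort.
split.
- by rewrite -size_eq0 size_sort size_cat addn_eq0 negb_and size_eq0 f0.
- exact: (sort_sorted leT_total).
- by rewrite (perm_all _ fg) all_cat cf.
apply: giso_trans (giso_sum Xf Yg) (giso_trans (giso_sym (gF_cat _ _)) _).
by apply: giso_sym; exact: gF_perm.
Qed.

(** Complementation puts a root above a forest that is not a single tree, and strips the root of a
    single tree; a lone leaf is fixed. *)
Lemma rep_compl X : rep X -> rep (gcompl X).
Proof.
case=> f [f0 sf cf Xf]; have [f1|f1] := boolP (size f == 1)%N; last first.
  exists [:: Node f]; split=> //=; first by rewrite f1 sf cf.
  apply: giso_trans (giso_compl Xf) (giso_sym _).
  by rewrite -/(gT (Node f)) gT_Node //; exact: gsum0.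
case: f f1 f0 sf cf Xf => [|[s] []] // _ _ _ /= /andP[/and3P[_ ss cs] _].
have [->|s0] := eqVneq s [::] => Xs.
  apply: (rep_giso _ rep_K1); apply: giso_trans (giso_compl Xs) _.
  apply: giso_trans (giso_compl (gsum0 _)) _.
  by exists id => [|[] []] //; exists id.
exists s; split=> //; apply: giso_trans (giso_compl Xs) _.
apply: giso_trans (giso_compl (gsum0 _)) _.
rewrite -/(gT (Node s)) gT_Node //; apply: gcomplK; by case: (gsimple_gF s).
Qed.

Definition fg n (E : graph n) : fgraph := @FGraph 'I_n (fun x y => (x, y) \in E).

Lemma fg_K1 : giso (fg (finset.set0 : graph 1)) gK1.
Proof.
exists (fun _ => tt); first by exists (fun _ => ord0) => [x|[] //]; exact/esym/ord1.
by move=> x y /=; rewrite finset.in_set0.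
Qed.

Lemma fg_compl n (E : graph n) : giso (fg (graph_complement E)) (gcompl (fg E)).
Proof.
exists id; first by exists id.
by move=> x y /=; rewrite finset.in_set.
Qed.

Lemma fg_dunion m k (E : graph m) (F : graph k) :
  giso (fg (graph_dunion E F)) (gsum (fg E) (fg F)).
Proof.
exists (@split m k : fg (graph_dunion E F) -> gsum (fg E) (fg F)).
  by exists (@unsplit m k); [exact: splitK | exact: unsplitK].
by move=> x y /=; rewrite finset.in_set /=; case: (split x); case: (split y).
Qed.

Lemma graph_isoP n (E F : graph n) : graph_iso E F <-> giso (fg E) (fg F).
Proof.
split=> [[s sE]|[f fb fA]].
  by exists s => [|x y]; [exact/injF_bij/perm_inj | rewrite /= sE].
exists (perm (bij_inj fb)) => x y; rewrite !permE; exact/esym/fA.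
Qed.

Lemma cograph_rep n (E : graph n) : cograph E -> rep (fg E).
Proof.
elim=> {n E} [|n E _ IH|m k E F _ IHE _ IHF|n E F _ IH EF].
- exact: rep_giso fg_K1 rep_K1.
- exact: rep_giso (fg_compl E) (rep_compl IH).
- exact: rep_giso (fg_dunion E F) (rep_sum IHE IHF).
- by apply: rep_giso IH; apply/giso_sym/graph_isoP.
Qed.

Lemma gsimple_giso X Y : giso X Y -> gsimple Y -> gsimple X.
Proof.
by case=> f _ fA [sY iY]; split=> [x y|x]; rewrite -!fA.
Qed.

Lemma simple_graphP n (E : graph n) : reflect (gsimple (fg E)) (simple_graph E).
Proof.
apply: (iffP andP) => [[/forallP sE /forallP iE]|[sE iE]]; split.
- by move=> x y; have /forallP/(_ y)/eqP := sE x.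
- by move=> x; apply/negbTE/iE.
- by apply/forallP => x; apply/forallP => y; apply/eqP/sE.
- by apply/forallP => x; apply/negbT/iE.
Qed.

Lemma P4_free_F f : {in f, forall t, ~ hasP4 (gT t)} -> ~ hasP4 (gF f).
Proof.
elim: f => [_ [[]]|c f IH H] //= /hasP4_sum[|]; first by apply: H; rewrite mem_head.
by apply: IH => t tf; apply: H; rewrite inE tf orbT.
Qed.

Lemma P4_free_T t : ~ hasP4 (gT t).
Proof.
elim/tree_ind_mem: t => s IH; have [->|s0] := eqVneq s [::].
  by case=> a [b [c [d [[]]]]].
rewrite gT_Node // => /hasP4_compl_inv-/(_ (gsimple_gF s)); exact: P4_free_F.
Qed.

Lemma P4_free_gF f : ~ hasP4 (gF f).
Proof. by apply: P4_free_F => t _; exact: P4_free_T. Qed.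

Definition cog (X : fgraph) := exists n (E : graph n), cograph E /\ giso (fg E) X.

Lemma cog_compl X : cog X -> cog (gcompl X).
Proof.
case=> n [E [cE EX]]; exists n, (graph_complement E); split; first exact: cograph_compl.
exact: giso_trans (fg_compl E) (giso_compl EX).
Qed.

Lemma cog_sum X Y : cog X -> cog Y -> cog (gsum X Y).
Proof.
case=> m [E [cE EX]] [k [F [cF FX]]].
exists (m + k)%N, (graph_dunion E F); split; first exact: cograph_union.
exact: giso_trans (fg_dunion E F) (giso_sum EX FX).
Qed.

Lemma cog_giso X Y : giso X Y -> cog X -> cog Y.
Proof.
by move=> XY [n [E [cE EX]]]; exists n, E; split=> //; exact: giso_trans XY.
Qed.

Lemma cog_F f : f != [::] -> {in f, forall t, cog (gT t)} -> cog (gF f).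
Proof.
elim: f => // c f IH _ H; have cc : cog (gT c) by apply: H; rewrite mem_head.
have [->|f0] := eqVneq f [::]; first exact: cog_giso (giso_sym (gsum0 _)) cc.
by apply: cog_sum => //; apply: IH => // t tf; apply: H; rewrite inE tf orbT.
Qed.

Lemma cog_T t : cog (gT t).
Proof.
elim/tree_ind_mem: t => s IH; have [->|s0] := eqVneq s [::].
  by exists 1%N, finset.set0; split; [exact: cograph_K1 | exact: fg_K1].
by rewrite gT_Node //; apply: cog_compl; apply: cog_F.
Qed.

Lemma cograph_of_forest f n : f != [::] -> fleaves f = n ->
  exists E : graph n, cograph E /\ giso (fg E) (gF f).
Proof.
move=> f0 <-; have [|k [E [cE EX]]] := cog_F f0 _; first by move=> t _; exact: cog_T.
(* [cog] leaves the number of vertices open; the cardinal identifies it with [fleaves f], and [E] is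
   transported along that equality. *)
have := giso_card EX; rewrite card_ord card_gF => kE.
by move: E cE EX; rewrite kE => E; exists E.
Qed.

(** The mate has an induced path on four vertices and [E] has none, so they are not isomorphic.
    Taking determinants in the conjugation relation and cancelling the nonzero [\det QM] equates the
    characteristic polynomials. *)
Lemma gmate_cospectral n (E : graph n) f :
  giso (fg E) (gF f) -> gmate (fg E) -> has_cospectral_mate E.
Proof.
move=> Ef [e [Q [ge pe _ _ [orth tw]]]].
pose F : graph n := [set p | e p.1 p.2]%SET.
have eF : giso (FGraph e) (fg F).
  by exists id; [exists id | move=> x y /=; rewrite finset.in_set].
exists F; split; last split.
- by apply/simple_graphP; exact: gsimple_giso (giso_sym eF) ge.
- move/graph_isoP => EF; apply: (@P4_free_gF f).
  apply: hasP4_giso Ef _; apply: hasP4_giso (giso_sym EF) _; exact: hasP4_giso eF pe.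
pose QM : 'M[algC]_n := \matrix_(i, j) Q i j.
have QQ : QM *m QM^T = 1%:M.
  by apply/matrixP => i j; rewrite !mxE -orth; apply: eq_bigr => z _; rewrite !mxE.
have AQ : adjmx E *m QM = QM *m adjmx F.
  apply/matrixP => i j; rewrite !mxE.
  have := tw i j; rewrite /adjC /= => T.
  transitivity (\sum_z ((i, z) \in E)%:R * Q z j); first by apply: eq_bigr => z _; rewrite !mxE.
  by rewrite T; apply: eq_bigr => z _; rewrite !mxE finset.in_set.
have [QU _] := mulmx1_unit QQ.
suff E1 : char_poly (adjmx E) = char_poly (adjmx F) by move=> lam; rewrite E1.
have : char_poly_mx (adjmx E) *m map_mx polyC QM = map_mx polyC QM *m char_poly_mx (adjmx F).
  by rewrite /char_poly_mx mulmxBl mulmxBr -!map_mxM AQ mul_scalar_mx mul_mx_scalar.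
move/(congr1 determinant); rewrite !det_mulmx mulrC => /mulfI; apply.
by rewrite det_map_mx polyC_eq0 -unitfE -unitmxE.
Qed.

Local Close Scope ring_scope.

(** * A nine-vertex cograph with a mate *)

Definition gadd1 (X : fgraph) := gsum gK1 X.
Definition gK3 := gcompl (gadd1 (gadd1 gK1)).
(** Three triangles sharing an edge, with a pendant vertex attached to one end of that edge. *)
Definition gspider := gcompl (gadd1 (gcompl (gadd1 (gcompl (gadd1 gK3))))).
Definition gbase := gsum gK3 gspider.

Lemma rep_base : rep gbase.
Proof.
have r1 X : rep X -> rep (gadd1 X) := @rep_sum gK1 X rep_K1.
have rK3 : rep gK3 by apply/rep_compl/r1/r1/rep_K1.
by apply: rep_sum => //; do 3 apply/rep_compl/r1.
Qed.

Definition nbrs (L : seq (seq nat)) : rel nat := fun i j => j \in nth [::] L i.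

Definition base_nbrs := [:: [:: 1; 2]; [:: 0; 2]; [:: 0; 1]; [:: 4; 5; 6; 7; 8];
  [:: 3]; [:: 3; 6; 7; 8]; [:: 3; 5]; [:: 3; 5]; [:: 3; 5]].

(** A complete graph on 0, 1, 2, 3 and a star with centre 5 and leaves 6, 7, 8, linked through
    vertex 4; the vertices 0, 3, 4, 5 induce a path. *)
Definition mate_nbrs := [:: [:: 1; 2; 3]; [:: 0; 2; 3]; [:: 0; 1; 3]; [:: 0; 1; 2; 4];
  [:: 3; 5]; [:: 4; 6; 7; 8]; [:: 5]; [:: 5]; [:: 5]].

Definition base_graph := @FGraph 'I_9 (fun i j => nbrs base_nbrs i j).

Definition all9 (q : nat -> nat -> bool) := all (fun i => all (q i) (iota 0 9)) (iota 0 9).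

Lemma all9P (q : nat -> nat -> bool) : all9 q -> forall i j : 'I_9, q i j.
Proof.
move=> H i j; have in9 (k : 'I_9) : (k : nat) \in iota 0 9 by rewrite mem_iota /= ltn_ord.
exact: (allP (allP H i (in9 i)) j (in9 j)).
Qed.

Definition base_vtx : seq gbase :=
  [:: inl (inl tt); inl (inr (inl tt)); inl (inr (inr tt));
      inr (inl tt); inr (inr (inl tt)); inr (inr (inr (inl tt)));
      inr (inr (inr (inr (inl tt)))); inr (inr (inr (inr (inr (inl tt)))));
      inr (inr (inr (inr (inr (inr tt)))))].

Lemma base_giso : giso base_graph gbase.
Proof.
pose v0 : gbase := inl (inl tt).
pose f (i : base_graph) : gbase := nth v0 base_vtx (i : 'I_9).
have fi : injective f.
  move=> i j E; apply/val_inj/eqP.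
  have := @all9P (fun i j => (nth v0 base_vtx i == nth v0 base_vtx j) ==> (i == j)) _ i j.
  rewrite -/(f i) -/(f j) E eqxx; apply; by vm_compute.
exists f; last first.
  move=> i j; apply/eqP.
  apply: (@all9P (fun i j => adj gbase (nth v0 base_vtx i) (nth v0 base_vtx j)
    == nbrs base_nbrs i j)).
  by vm_compute.
apply: inj_card_bij => //; rewrite card_ord.
by rewrite !card_gsum !card_unit.
Qed.

Local Open Scope ring_scope.

(* Five times the orthogonal matrix that conjugates the two adjacency matrices;
   it is constant on the blocks given by the twin classes [3 + 1 + 1 + 1 + 3],
   up to multiples of the identity in the two 3 by 3 diagonal blocks. *)
Definition base_conj : seq (seq int) :=
  [:: [:: 3; -2; -2; 0; 1; 2; 1; 1; 1];
      [:: -2; 3; -2; 0; 1; 2; 1; 1; 1];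
      [:: -2; -2; 3; 0; 1; 2; 1; 1; 1];
      [:: 2; 2; 2; 0; -1; 3; -1; -1; -1];
      [:: 1; 1; 1; 0; -3; -1; 2; 2; 2];
      [:: 0; 0; 0; 5; 0; 0; 0; 0; 0];
      [:: 1; 1; 1; 0; 2; -1; -3; 2; 2];
      [:: 1; 1; 1; 0; 2; -1; 2; -3; 2];
      [:: 1; 1; 1; 0; 2; -1; 2; 2; -3]].

Definition entry i j : int := (nth [::] base_conj i)`_j.

(** Integer sums in this form reduce by computation, so the matrix identities can be decided entry
    by entry. *)
Definition sum9 (F : nat -> int) : int := foldr (fun i x => F i + x) 0 (iota 0 9).

Lemma sum9E (F : nat -> int) : \sum_(i < 9) (F i)%:~R = (sum9 F)%:~R :> algC.
Proof.
by rewrite -rmorph_sum -(big_mkord xpredT) unlock.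
Qed.

Lemma gmate_base_graph : gmate base_graph.
Proof.
pose Q (i j : 'I_9) : algC := (entry i j)%:~R / 5%:R.
have n5 : 5%:R != 0 :> algC by rewrite pnatr_eq0.
have check (q : nat -> nat -> bool) : all9 q -> forall i j : 'I_9, q i j := @all9P q.
exists (fun i j : 'I_9 => nbrs mate_nbrs i j), Q; split.
- split=> [i j|i] /=.
    by apply/eqP; apply: (check (fun i j => nbrs mate_nbrs i j == nbrs mate_nbrs j i)).
  apply/negbTE; move: (i) => j.
  by have := check (fun i j => ~~ nbrs mate_nbrs i i) isT j j.
- by exists (inord 0), (inord 3), (inord 4), (inord 5); rewrite /= /nbrs !inordK.
- move=> i; rewrite -mulr_suml sum9E.
  have := check (fun i j => sum9 (entry i) == 5) isT i i => /eqP ->.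
  by rewrite divff.
- move=> j; rewrite -mulr_suml (sum9E (fun i => entry i j)).
  have := check (fun i j => sum9 (fun i => entry i j) == 5) isT j j => /eqP ->.
  by rewrite divff.
split=> i j.
- transitivity (\sum_(z < 9) (entry i z * entry j z)%:~R / (5%:R * 5%:R) : algC).
    by apply: eq_bigr => z _; rewrite /Q mulf_div rmorphM.
  rewrite -mulr_suml (sum9E (fun z => entry i z * entry j z)).
  have := check (fun i j => sum9 (fun z => entry i z * entry j z) == 25 * (i == j)%:Z) isT i j.
  move=> /eqP ->; rewrite rmorphM /= mulrAC -natrM divff ?mul1r ?pnatr_eq0 //.
transitivity (\sum_(z < 9) ((nbrs base_nbrs i z)%:Z * entry z j)%:~R / 5%:R : algC).
  by apply: eq_bigr => z _; rewrite /Q rmorphM /= mulrA.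
transitivity (\sum_(z < 9) (entry i z * (nbrs mate_nbrs z j)%:Z)%:~R / 5%:R : algC); last first.
  by apply: eq_bigr => z _; rewrite /Q rmorphM /= mulrAC.
rewrite -!mulr_suml (sum9E (fun z => (nbrs base_nbrs i z)%:Z * entry z j)).
rewrite (sum9E (fun z => entry i z * (nbrs mate_nbrs z j)%:Z)).
have := check (fun i j => sum9 (fun z => (nbrs base_nbrs i z)%:Z * entry z j) ==
  sum9 (fun z => entry i z * (nbrs mate_nbrs z j)%:Z)) isT i j.
by move=> /eqP ->.
Qed.

Local Close Scope ring_scope.

(** The canonical forest of [gbase] need not be computed: if it is a single tree, that tree works,
    and otherwise a root above it gives the complement of [gbase], which inherits the mate. *)
Lemma mate_tree : exists M, [/\ canon M, 2 < leaves M & gmate (gT M)].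
Proof.
have [f [f0 sf cf Xf]] := rep_base.
have mf : gmate (gF f).
  exact: gmate_giso Xf (gmate_giso base_giso gmate_base_graph).
have lf : fleaves f = 9.
  by rewrite -card_gF -(giso_card Xf) -(giso_card base_giso) card_ord.
have [f1|f1] := boolP (size f == 1); last first.
  exists (Node f); split; first by rewrite /= f1 sf.
    by rewrite leaves_Node // lf.
  by rewrite gT_Node //; apply: gmate_compl => //; exact: gsimple_gF.
case: f f1 f0 sf cf Xf mf lf => [|t []] // _ _ _ /= /andP[ct _] _ mt.
rewrite /fleaves /= addn0 => lt; exists t; split=> //; first by rewrite lt.
exact: gmate_giso (gsum0 _) mt.
Qed.

(** * Isomorphism classes *)

Section Classes.

Variable n : nat.

Definition iso_class (E : graph n) : {set graph n} :=
  [set F in cographs n | `[< graph_iso E F >]]%SET.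

Lemma cograph_classesE : cograph_classes n = [set iso_class E | E in cographs n]%SET.
Proof. by []. Qed.

Lemma mem_iso_class E F : F \in iso_class E -> giso (fg E) (fg F).
Proof. by rewrite finset.inE => /andP[_ /asboolP /graph_isoP]. Qed.

Lemma iso_class_refl E : E \in cographs n -> E \in iso_class E.
Proof.
by move=> cE; rewrite finset.inE cE; apply/asboolP/graph_isoP; exact: giso_refl.
Qed.

Lemma iso_class_eq E F : giso (fg E) (fg F) -> iso_class E = iso_class F.
Proof.
move=> EF; apply/finset.setP => K; rewrite !finset.inE; congr (_ && _).
apply/asboolP/asboolP => /graph_isoP H; apply/graph_isoP.
  exact: giso_trans (giso_sym EF) H.
exact: giso_trans EF H.
Qed.

Lemma mem_cographs E : (E \in cographs n) = `[< cograph E >].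
Proof.
rewrite finset.inE; apply: andb_idl => /asboolP /cograph_rep[f [_ _ _ Ef]].
by apply/simple_graphP; apply: gsimple_giso Ef (gsimple_gF f).
Qed.

(** Distinct canonical trees have non-isomorphic graphs by [gT_inj], so they yield distinct
    classes. *)
Lemma trees_le_classes p : subpred p canon -> size (trees p n) <= c_num n.
Proof.
move=> pc.
have [h hP] : exists h : tree -> graph n, forall t, leaves t = n ->
    cograph (h t) /\ giso (fg (h t)) (gT t).
  suff /choice[h hP] : forall t, exists E : graph n, leaves t = n ->
      cograph E /\ giso (fg E) (gT t) by exists h.
  move=> t; have [lt|lt] := eqVneq (leaves t) n; last first.
    (* The empty graph is a dummy value for trees of the wrong size. *)
    by exists finset.set0 => E; rewrite E eqxx in lt.
  have [|E [cE Et]] := @cograph_of_forest [:: t] n isT; first by rewrite /fleaves /= addn0.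
  by exists E => _; split=> //; exact: giso_trans Et (gsum0 _).
rewrite /c_num cardE; apply: (@size_inj_le _ _ (fun t => iso_class (h t))).
- exact: trees_uniq.
- move=> t t'; rewrite !mem_trees // => /andP[pt /eqP /hP[ct it]] /andP[pt' /eqP /hP[ct' it']] E.
  have : h t' \in iso_class (h t') by apply: iso_class_refl; rewrite mem_cographs; apply/asboolP.
  rewrite -E => /mem_iso_class H; apply: gT_inj; try exact: pc.
  exact: giso_trans (giso_sym it) (giso_trans H it').
move=> t; rewrite mem_trees // => /andP[pt /eqP /hP[ct _]].
rewrite mem_enum cograph_classesE; apply: finset.imset_f.
by rewrite mem_cographs; apply/asboolP.
Qed.

Definition mate_classes :=
  [set C in cograph_classes n | `[< exists2 E, E \in C & has_cospectral_mate E >]]%SET.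

(** A forest with a tree containing [M] would give its class a mate, so a mateless class is
    represented by an avoiding forest, which in turn determines the class. *)
Lemma mateless_le_forests M : gmate (gT M) -> 0 < n ->
  #|finset.setD (cograph_classes n) mate_classes| <= size (forests (avoiding M) n).
Proof.
move=> mM n_gt0; set bad := finset.setD _ _.
have [k kP] : exists k : {set graph n} -> seq tree, forall C, C \in bad ->
    k C \in forests (avoiding M) n /\ exists2 E, C = iso_class E & giso (fg E) (gF (k C)).
  suff /choice[k kP] : forall C, exists f, C \in bad -> f \in forests (avoiding M) n /\
    exists2 E, C = iso_class E & giso (fg E) (gF f) by exists k.
  move=> C.
  have [Cbad|Cbad] := boolP (C \in bad); last by exists [::].
  move: (Cbad); rewrite /bad finset.in_setD cograph_classesE finset.in_set => /andP[nomate].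
  move=> CC; move: nomate; rewrite cograph_classesE CC /= => /asboolPn nomate.
  have [E cE CE] := finset.imsetP CC.
  have [f [f0 sf cf Ef]] : rep (fg E) by apply: cograph_rep; apply/asboolP; rewrite -mem_cographs.
  exists f => _; split; last by exists E.
  rewrite mem_forests; last by move=> t /andP[].
  apply/and3P; split=> //; last by rewrite -card_gF -(giso_card Ef) card_ord.
  apply/allP => c cf'; rewrite /avoiding (allP cf) //=; apply/negP => Mc.
  apply: nomate; exists E; first by rewrite CE; exact: iso_class_refl.
  apply: (gmate_cospectral Ef); apply: (gmate_giso (giso_sym Ef)).
  exact: gmate_mem cf' (gmate_T mM Mc).
rewrite cardE; apply: (@size_inj_le _ _ k); first exact: enum_uniq.
  move=> C C'; rewrite !mem_enum => /kP[_ [E -> iE]] /kP[_ [E' -> iE']] kk.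
  by apply: iso_class_eq; rewrite -kk in iE'; exact: giso_trans iE (giso_sym iE').
by move=> C; rewrite mem_enum => /kP[].
Qed.

Lemma c_num_split : c_num n = d_num n + #|finset.setD (cograph_classes n) mate_classes|.
Proof.
rewrite /c_num -(finset.cardsID mate_classes); congr (_ + _).
rewrite /d_num; apply: eq_card => C; rewrite !finset.inE.
by case: (C \in cograph_classes n).
Qed.

End Classes.

(** * From the counting bounds to the limit *)

Lemma d_num_asymp : exists G, forall A, exists N, forall n, N <= n ->
  [/\ 0 < c_num n, d_num n <= c_num n & A * (c_num n - d_num n) <= G * c_num n].
Proof.
have [M [cM lM mM]] := mate_tree.
have [G HG] := containing_dominates cM lM.
(* Using [A.+1] keeps the left-hand side positive even for [A = 0], which forces [u], and hence
   [c_num n], to be positive. *)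
exists G => A; have [N HN] := HG A.+1; exists N.+1 => n n_ge.
have le1 := HN n ltac:(lia).
have le2 := trees_le_classes n (@containing_canon M).
have le3 := mateless_le_forests (n := n) mM ltac:(lia).
have pos : 0 < size (forests (avoiding M) n).
  apply: leq_trans (sg_homo (avoiding_forests_mono lM) (leq0n n)).
  by rewrite forests0.
have E := c_num_split n.
move: le1 le2 le3 pos E; move: (size _) (size _) (#|_|) (c_num n) (d_num n).
move=> u sg b c d le1 le2 le3 pos E.
have : G * u <= G * c by rewrite leq_mul2l le2 orbT.
have : A * b <= A * sg by rewrite leq_mul2l le3 orbT.
split; [|lia|]; last first.
  have -> : c - d = b by lia.
  lia.
rewrite lt0n; apply/eqP => c0; have u0 : u = 0 by lia.
by rewrite u0 muln0 in le1; lia.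
Qed.

From mathcomp Require Import all_classical all_reals all_analysis.
Import numFieldNormedType.Exports.
Local Open Scope classical_set_scope.
Local Open Scope ring_scope.

Theorem theorem1p1 (R : realType) :
  (fun n : nat => (d_num n)%:R / (c_num n)%:R : R) @ \oo --> (1 : R).
Proof.
have [G HG] := d_num_asymp.
apply/cvgrPdist_lt => eps eps_gt0.
have Ge_ge0 : 0 <= (G%:R / eps : R) by rewrite divr_ge0 // ltW.
(* Choosing [A] above [G / eps] makes the mateless proportion, at most [G / A], smaller than
   [eps]. *)
have [N HN] := HG (Num.bound (G%:R / eps : R)).
exists N => // n /= n_ge; have [c_gt0 d_le le_AG] := HN n n_ge.
have c_gt0' : 0 < (c_num n)%:R :> R by rewrite ltr0n.
have -> : 1 - (d_num n)%:R / (c_num n)%:R = (c_num n - d_num n)%:R / (c_num n)%:R :> R.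
  by rewrite natrB // mulrBl divff // gt_eqF.
rewrite ger0_norm; last by rewrite divr_ge0.
rewrite ltr_pdivrMr //.
have := archi_boundP Ge_ge0; rewrite ltr_pdivrMr // => lt_GA.
move: le_AG; rewrite -(ler_nat R) !natrM => le_AG.
have A_gt0 : 0 < (Num.bound (G%:R / eps : R))%:R :> R.
  exact: le_lt_trans Ge_ge0 (archi_boundP Ge_ge0).
rewrite -(ltr_pM2l A_gt0); apply: le_lt_trans le_AG _.
by rewrite mulrA ltr_pM2r.
Qed.
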